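(* Let $\mathcal{C}$ be the equivalence class (with respect to $\sim$) of some weighted forest. Then any two minimal elements of $\mathcal{C}$ have isomorphic skeletons.
   Context: Graphs are finite, undirected, without loops or multiple edges; a weighted graph has an integer weight at each vertex; a forest is a graph without cycles. Blowing-up of a weighted graph $\mathcal G$: (i) at a vertex $v$: add a new vertex $e$ of weight $-1$ joined to $v$, and decrease the weight of $v$ by $1$; (ii) at an edge $\{v_1,v_2\}$: delete the edge, add a new vertex $e$ of weight $-1$ joined to $v_1$ and to $v_2$, and decrease the weights of $v_1,v_2$ by $1$; (iii) free: add an isolated vertex $e$ of weight $-1$. (Any weighted graph isomorphic to such a graph is also called a blowing-up.) Blowing-down is the inverse operation. $\mathcal{G}\sim\mathcal{G}'$ (equivalent) means that one can be obtained from the other by a finite sequence of blowings-up and blowings-down. A vertex $e$ is contractible if it has weight $-1$, has at most two neighbours, and any two distinct neighbours of $e$ are not adjacent; a weighted graph is minimal if it has no contractible vertex. For a forest $G$ (weights, if any, are ignored), $P(G)$ is the set of nonempty sequences $(v_0,\dots,v_n)$ of vertices such that either $n=0$ and $\deg(v_0)=0$; or $n>0$, the $v_i$ are distinct, consecutive ones are adjacent, and $\{i:\deg(v_i)\neq 2\}=\{0,n\}$. $\operatorname{Vtx}_{\ne2}(G)$ is the set of vertices of degree $\ne 2$. A skeletal map $f:G\dashrightarrow G'$ between forests is a map $f:\operatorname{Vtx}_{\neq2}(G)\to\operatorname{Vtx}_{\neq2}(G')$ such that: for each $\gamma=(v_0,\dots,v_m)\in P(G)$ there is a (necessarily unique)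 $\gamma'=(v'_0,\dots,v'_n)\in P(G')$ with $f(v_0)=v'_0$, $f(v_m)=v'_n$; the resulting map $\vec f:P(G)\to P(G')$, $\gamma\mapsto\gamma'$, is surjective; and if $u\ne v$ are in the domain of $f$ and $f(u)=f(v)$ then some $(v_0,\dots,v_m)\in P(G)$ has $v_0=u$, $v_m=v$. A skeleton is a (non-weighted) forest with no vertex of degree $0$ or $2$. The skeleton of a weighted forest $\mathcal G$ is a skeleton $S$ for which there is a skeletal map $S\dashrightarrow\mathcal G$; it exists and is unique up to isomorphism of graphs. *)

(* Defs.v *)
From HB Require Import structures.
From Stdlib Require Import Relation_Operators.
From mathcomp Require Import all_boot all_order all_algebra.

Set Implicit Arguments.
Unset Strict Implicit.
Unset Printing Implicit Defensive.

Record graph := Graph {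
  vertex :> finType;
  adj : rel vertex;
  adj_sym : symmetric adj;
  adj_irr : irreflexive adj }.

Record wgraph := WGraph {
  ugraph :> graph;
  weight : ugraph -> int }.

Definition deg (G : graph) (x : G) : nat := #|[set y | adj x y]|.

(* A graph cycle is a duplicate-free cyclic sequence of at least 3 vertices:
   [:: x; y] is a [ucycle] as soon as x and y are adjacent. *)
Definition forest (G : graph) : Prop :=
  forall c : seq G, ucycle (@adj G) c -> size c < 3.

Definition graph_iso (G H : graph) : Prop :=
  exists2 f : G -> H, bijective f & forall x y, adj (f x) (f y) = adj x y.

Definition wgraph_iso (G H : wgraph) : Prop :=
  exists f : G -> H, [/\ bijective f,
    forall x y, adj (f x) (f y) = adj x y &
    forall x, weight (f x) = weight x].

(* Common form of the three blowings-up: a new vertex [None] of weight -1 is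
   joined to all the vertices of A, the edges joining two vertices of A are
   deleted, and the weights of the vertices of A are decreased by 1.  The
   cases A = {v}, A = {v1, v2} with v1 and v2 adjacent, and A = set0 are the
   blowings-up at v, at the edge {v1, v2}, and the free one. *)
Section BlowUp.
Variables (G : wgraph) (A : {set G}).

Definition blow_adj (a b : option G) : bool :=
  match a, b with
  | Some x, Some y => adj x y && ~~ ((x \in A) && (y \in A))
  | Some x, None | None, Some x => x \in A
  | None, None => false
  end.

Lemma blow_adj_sym : symmetric blow_adj.
Proof. by move=> [x|] [y|] //=; rewrite adj_sym andbC [(x \in A) && _]andbC andbC. Qed.

Lemma blow_adj_irr : irreflexive blow_adj.
Proof. by move=> [x|] //=; rewrite adj_irr. Qed.

Definition blow_weight (a : option G) : int :=
  if a is Some x then (weight x - (x \in A)%:R)%R else (-1)%R.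

Definition blow : wgraph :=
  @WGraph (Graph blow_adj_sym blow_adj_irr) blow_weight.
End BlowUp.

(* [blowing_up G H]: H is a blowing-up of G, and G is a blowing-down of H. *)
Variant blowing_up (G H : wgraph) : Prop :=
  | BlowVertex (v : G) of wgraph_iso (blow [set v]) H
  | BlowEdge (v1 v2 : G) of adj v1 v2 & wgraph_iso (blow [set v1; v2]) H
  | BlowFree of wgraph_iso (blow (@set0 G)) H.

Definition wequiv : wgraph -> wgraph -> Prop :=
  clos_refl_sym_trans wgraph blowing_up.

Definition contractible (G : wgraph) (e : G) : Prop :=
  [/\ weight e = (-1)%R, deg e <= 2 &
      forall x y, adj e x -> adj e y -> x != y -> ~~ adj x y].

Definition minimal (G : wgraph) : Prop := forall e : G, ~ contractible e.

(* Membership in P(G); in the last case p is nonempty and the sequence is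
   (v_0, ..., v_n) with n = size p. *)
Definition in_P (G : graph) (g : seq G) : Prop :=
  match g with
  | [::] => False
  | [:: v0] => deg v0 = 0
  | v0 :: p =>
      [/\ uniq g, path (@adj G) v0 p &
          forall i, i <= size p ->
            (deg (nth v0 g i) != 2) = (i == 0) || (i == size p)]
  end.

Definition Vtx_ne2 (G : graph) := {v : G | deg v != 2}.

(* g is an element of P(G) that begins at u and ends at v. *)
Definition P_joins (G : graph) (u v : Vtx_ne2 G) (g : seq G) : Prop :=
  [/\ in_P g, ohead g = Some (val u) & last (val u) g = val v].

(* The endpoints of an element of P(G) have degree <> 2, so the quantification
   over u and v covers all of P(G).  When H is a forest an element of P(H) is
   determined by its endpoints, so vf is, on P(G), the map induced by f. *)
Definition skeletal_map (G H : graph) (f : Vtx_ne2 G -> Vtx_ne2 H) : Prop :=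
  (exists vf : seq G -> seq H,
     (forall u v g, P_joins u v g -> P_joins (f u) (f v) (vf g)) /\
     (forall h, in_P h -> exists2 g, in_P g & vf g = h)) /\
  (forall u v, u != v -> f u = f v -> exists g, P_joins u v g).

Definition skeleton (S : graph) : Prop :=
  forest S /\ forall v : S, deg v != 0 /\ deg v != 2.

Definition skeleton_of (S G : graph) : Prop :=
  skeleton S /\ exists f : Vtx_ne2 S -> Vtx_ne2 G, skeletal_map f.

(* Main.v *)
Require Import Defs.
From mathcomp Require Import all_boot all_order all_algebra.

(** The number of live branches at a vertex decides everything.  Fix a weighted
   forest G.  A set D of vertices is dead if all of its vertices can be removed
   by successive contractions at vertices of D.  A branch at u is a component of
   G - u adjacent to u; u is a node if at least three of its branches are not
   dead.  The invariants of G are the set of its nodes, the relation between two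
   nodes joined by a path without other nodes, the number of live branches at
   each node, and the number of components that are not dead and contain no
   node.

   These invariants do not change under blowing-up ([contraction_same]): the new
   vertex has at most two neighbours, so it is not a node; connectedness is the
   same in both graphs; and a branch is dead in one graph if and only if the
   corresponding branch is dead in the other.  The last point is the heart of the
   matter ([erasable_rem]): if D can be erased at all, then it can be erased
   starting with any admissible vertex.  Indeed two contractions at nonadjacent
   vertices commute, and two adjacent vertices of weight -1 never occur in an
   erasable set, because contracting one gives weight 0 to the other, weights do
   not decrease, and a vertex of nonnegative weight is never contracted.

   In a minimal forest no nonempty set is dead ([minimal_same]), so its nodes are
   its vertices of degree at least 3 and its invariants ignore the weights.  They
   coincide with the invariants of a skeleton: this is proved by smoothing the
   vertices of degree 2 one by one ([smooth_skeleton], [smooth_same]) down to the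
   case where there are none left ([no_chain_same]).  Finally a skeleton can be
   rebuilt from its invariants ([same_skeleton_iso]): the number of leaves at a
   node is the number of its live branches minus the number of adjacent nodes,
   and the components without nodes are single edges. *)

Set Implicit Arguments.
Unset Strict Implicit.
Unset Printing Implicit Defensive.

(** * Erasing a set of vertices by contractions *)
(** Contractions are performed without changing the vertex type: a contracted
   vertex merely becomes isolated.  Contractions at different vertices can then
   be compared by plain extensional equality, with no isomorphism. *)
Section Erase.
Variable V : finType.
Implicit Types (a : rel V) (w : V -> int) (s : seq V) (D : {set V}).

Definition contract a e : rel V :=
  fun x y => [&& x != e, y != e & a x y || [&& x != y, a x e & a e y]].
Definition contract_weight a w e : V -> int := fun x => (w x + (a e x)%:R)%R.
Definition collapsible a w e := (w e == -1)%R && (#|[set y | a e y]| <= 2).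

Fixpoint erasable a w s :=
  if s is e :: s' then
    collapsible a w e && erasable (contract a e) (contract_weight a w e) s'
  else true.

Lemma contract_sym a e : symmetric a -> symmetric (contract a e).
Proof.
move=> sa x y; rewrite /contract (sa y x) (eq_sym y x) (sa x e) (sa e y).
by case: (x == e); case: (y == e); rewrite //= (andbC (a e x)).
Qed.

Lemma eq_contract a a' e : a =2 a' -> contract a e =2 contract a' e.
Proof. by move=> eqa x y; rewrite /contract !eqa. Qed.

Lemma eq_erasable a a' w w' s :
  a =2 a' -> w =1 w' -> erasable a w s = erasable a' w' s.
Proof.
elim: s a a' w w' => //= e s IHs a a' w w' eqa eqw; congr (_ && _).
  rewrite /collapsible eqw; congr (_ && (_ <= _)).
  by apply: eq_card => y; rewrite !inE eqa.
by apply: IHs; [apply: eq_contract | move=> x; rewrite /contract_weight eqw eqa].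
Qed.

Lemma collapsible_contract a w e d : symmetric a -> d != e -> ~~ a e d ->
  collapsible (contract a e) (contract_weight a w e) d = collapsible a w d.
Proof.
move=> sa de ned; rewrite /collapsible /contract_weight (negbTE ned) GRing.addr0.
congr (_ && (_ <= _)); apply: eq_card => y; rewrite !inE /contract de (sa d e).
rewrite (negbTE ned) /= andbF orbF; case: eqP => //= ->.
by rewrite sa (negbTE ned).
Qed.

Lemma contractC a e d : symmetric a -> ~~ a e d ->
  contract (contract a e) d =2 contract (contract a d) e.
Proof.
move=> sa ned x y; case: (eqVneq e d) => [-> //|e_d]; rewrite /contract /=.
have nde : a d e = false by rewrite sa (negbTE ned).
rewrite !(negbTE ned) !nde !andbF !orbF ?e_d ?(eq_sym d e) ?e_d /=.
case: (x == e); case: (x == d); case: (y == e); case: (y == d); case: (x == y);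
  by case: (a x y) (a x e) (a e y) (a x d) (a d y) => [] [] [] [] [].
Qed.

Lemma contract_weightC a w e d : symmetric a -> ~~ a e d -> e != d ->
  contract_weight (contract a e) (contract_weight a w e) d =1
  contract_weight (contract a d) (contract_weight a w d) e.
Proof.
move=> sa ned e_d x; rewrite /contract_weight /contract.
have nde : a d e = false by rewrite sa (negbTE ned).
have nee : (d == e) = false by rewrite eq_sym (negbTE e_d).
rewrite !nde (negbTE ned) !andbF !orbF nee (negbTE e_d) /=.
case: (eqVneq x e) => [->|_]; first by rewrite nde (negbTE e_d) !GRing.addr0.
case: (eqVneq x d) => [->|_] /=; first by rewrite (negbTE ned) !GRing.addr0.
exact: GRing.addrAC.
Qed.

(** Contractions never lower the weight of a surviving vertex, so a vertex of
   nonnegative weight never reaches the weight -1. *)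
Lemma erasable_ge0 a w s v :
  v \in s -> (0 <= w v)%R -> ~~ erasable a w s.
Proof.
elim: s a w => //= e s IHs a w; rewrite inE.
case: (eqVneq v e) => [<- _ wv|_ /= vs wv].
  by rewrite /collapsible; case: eqP wv => // ->.
rewrite negb_and IHs ?orbT // /contract_weight.
by apply: Num.Theory.addr_ge0 => //; case: (a e v).
Qed.

(** Confluence: the order of the contractions does not matter.  Contractions at
   two nonadjacent vertices commute.  Two adjacent vertices of weight -1 cannot
   both be erased, because contracting one of them gives the other the weight
   0; this excludes the only critical pair. *)
Lemma erasable_rem a w s e : symmetric a -> uniq s -> e \in s ->
  collapsible a w e -> erasable a w s ->
  erasable (contract a e) (contract_weight a w e) (rem e s).
Proof.
move=> sa us es ce; elim: s a w sa us es ce => //= d s IHs a w sa.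
case/andP=> ds us; rewrite inE => es ce /andP[cd er].
case: (eqVneq d e) es er => [<- //|ded /= es er].
case: (boolP (a d e)) => [ade|nade].
  (* after the contraction at d the vertex e has weight 0 *)
  suff /negP : ~~ erasable (contract a d) (contract_weight a w d) s by case.
  apply: erasable_ge0 es _; rewrite /contract_weight ade.
  by case/andP: ce => /eqP->.
have nade' : ~~ a e d by rewrite sa.
rewrite collapsible_contract // cd /=.
rewrite (eq_erasable _ (contractC sa nade') (contract_weightC _ sa nade' _));
  last by rewrite eq_sym.
by apply: IHs => //; [apply: contract_sym | rewrite collapsible_contract // eq_sym].
Qed.

(** For the branches that the new vertex of a blowing-up does not touch: a
   contraction away from s changes neither weights nor degrees in s. *)
Lemma erasable_contract a w s e : symmetric a -> e \notin s ->
  {in s, forall x, ~~ a e x} ->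
  erasable (contract a e) (contract_weight a w e) s = erasable a w s.
Proof.
move=> sa es nadj; elim: s a w sa es nadj => //= d s IHs a w sa.
rewrite inE negb_or eq_sym => /andP[de es] nadj.
have ned : ~~ a e d by apply: nadj; rewrite mem_head.
rewrite collapsible_contract //; congr (_ && _).
rewrite (eq_erasable _ (contractC sa ned) (contract_weightC _ sa ned _));
  last by rewrite eq_sym.
apply: IHs => //; first exact: contract_sym.
move=> x xs; apply/negP=> /and3P[_ _ /orP[|/and3P[_ aed _]]].
  by apply/negP/nadj; rewrite inE xs orbT.
by rewrite aed in ned.
Qed.

(** Vertices outside D are never contracted, but they count in the degrees: a
   vertex of D attached to a fixed outside vertex still has to satisfy the
   degree bound in the whole graph. *)
Definition dead a w D := has (erasable a w) (permutations (enum D)).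

Lemma deadP a w D :
  reflect (exists s, [/\ uniq s, s =i D & erasable a w s]) (dead a w D).
Proof.
apply: (iffP hasP) => [[s]|[s [us sD er]]].
  rewrite mem_permutations => pe er; exists s; split=> //.
    by rewrite (perm_uniq pe) enum_uniq.
  by move=> x; rewrite (perm_mem pe) mem_enum.
exists s => //; rewrite mem_permutations; apply: uniq_perm => //.
  exact: enum_uniq.
by move=> x; rewrite sD mem_enum.
Qed.

Lemma dead_contract a w D e : symmetric a -> collapsible a w e ->
  e \in D \/ (e \notin D /\ {in D, forall x, ~~ a e x}) ->
  dead a w D = dead (contract a e) (contract_weight a w e) (D :\ e).
Proof.
move=> sa ce [eD|[eD nadj]]; apply/deadP/deadP => -[s [us sD er]].
- exists (rem e s); split; first exact: rem_uniq.
    by move=> x; rewrite mem_rem_uniq // !inE sD.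
  by apply: erasable_rem => //; rewrite sD.
- exists (e :: s); rewrite /= ce er us sD !inE eqxx; split=> //.
  by move=> x; rewrite inE sD !inE; case: eqP => // ->.
- exists s; split=> //.
    by move=> x; rewrite sD !inE; case: eqP => // ->; apply: negbTE.
  by rewrite erasable_contract // ?sD // => x; rewrite sD; apply: nadj.
- have sD' : s =i D.
    by move=> x; rewrite sD !inE; case: eqP => // ->; apply/esym/negbTE.
  exists s; split=> //.
  rewrite -(@erasable_contract _ _ _ e) // ?sD' // => x; rewrite sD'.
  exact: nadj.
Qed.

Lemma dead1 a w e : collapsible a w e -> dead a w [set e].
Proof.
by move=> ce; apply/deadP; exists [:: e]; split=> [//|x|/=]; rewrite ?inE ?ce.
Qed.

Lemma dead_collapsible a w D : D != set0 -> dead a w D ->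
  exists2 e, e \in D & collapsible a w e.
Proof.
case/set0Pn=> x xD /deadP[[|e s] [_ sD]]; first by rewrite -sD in xD.
by case/andP=> ce _; exists e; rewrite // -sD mem_head.
Qed.
End Erase.

Lemma erasable_map (V V' : finType) (i : V' -> V) (a : rel V) w
    (a' : rel V') w' s :
  injective i -> (forall x y, a (i x) y -> y \in codom i) ->
  (forall x y, a' x y = a (i x) (i y)) -> (forall x, w' x = w (i x)) ->
  erasable a' w' s = erasable a w (map i s).
Proof.
move=> inj_i; elim: s a w a' w' => //= e s IHs a w a' w' cod eqa eqw.
congr (_ && _); last first.
  apply: IHs => [x y|x y|x].
  - by case/and3P=> _ _ /orP[/cod //|/and3P[_ _ /cod]].
  - by rewrite /contract !eqa !inj_eq.
  - by rewrite /contract_weight eqw eqa.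
rewrite /collapsible eqw; congr (_ && (_ <= _)).
rewrite -(card_imset _ inj_i); apply: eq_card => y.
rewrite inE; apply/imsetP/idP => [[x]|aiy]; first by rewrite inE eqa => ax ->.
by have /codomP[x def_y] := cod _ _ aiy; exists x; rewrite // inE eqa -def_y.
Qed.

Lemma dead_map (V V' : finType) (i : V' -> V) (a : rel V) w
    (a' : rel V') w' (D : {set V}) :
  injective i -> (forall x y, a (i x) y -> y \in codom i) ->
  (forall x y, a' x y = a (i x) (i y)) -> (forall x, w' x = w (i x)) ->
  D \subset codom i ->
  dead a w D = dead a' w' (i @^-1: D).
Proof.
move=> inj_i cod eqa eqw Di; apply/deadP/deadP => -[s [us sD er]]; last first.
  exists (map i s); rewrite map_inj_uniq // -(erasable_map s inj_i cod eqa eqw).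
  split=> // y; apply/mapP/idP => [[x xs ->]|yD].
    by rewrite sD inE in xs.
  have /codomP[x def_y] := subsetP Di y yD.
  by exists x; rewrite // sD inE -def_y.
have [t def_s] : exists t, s = map i t.
  have /subsetP : {subset s <= codom i}.
    by move=> x; rewrite sD; apply: (subsetP Di).
  elim: s {us sD er} => [|x s IHs] /subsetP si; first by exists [::].
  have [|t ->] := IHs.
    by apply/subsetP=> y ys; rewrite si // inE ys orbT.
  by have /codomP[y ->] := si x (mem_head _ _); exists (y :: t).
exists t; rewrite -(map_inj_uniq inj_i) -def_s (erasable_map t inj_i cod eqa eqw).
rewrite -def_s; split=> // x.
by rewrite -(mem_map inj_i) -def_s sD inE.
Qed.

(** * Live branches and nodes *)
Lemma connect_ind (T : finType) (e : rel T) (P : T -> Prop) (x : T) :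
  P x -> (forall y z, connect e x y -> P y -> e y z -> P z) ->
  forall y, connect e x y -> P y.
Proof.
move=> Px stepP y /connectP[p ep ->] {y}.
elim/last_ind: p ep => //= p y IHp; rewrite rcons_path last_rcons.
case/andP=> ep; apply: stepP; last exact: IHp.
by apply/connectP; exists p.
Qed.

(** A graph with a family of vertex sets declared negligible.  For a weighted
   graph these are the dead sets; for a skeleton, which has no weights, only the
   empty set is negligible.  The same invariants then apply to both. *)
Record lgraph := LGraph { base :> graph; lost : pred {set base} }.

Section Invariants.
Variable G : lgraph.
Implicit Types (X : pred G) (u v x y : G).

Definition inside X : rel G := fun x y => [&& X x, X y & adj x y].
Definition component X x : {set G} := [set y | connect (inside X) x y].
Definition full : pred G := fun _ => true.
Definition off u : pred G := fun x => x != u.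

(** The branches at u are the components of G - u that contain a neighbour of u.
   Branches are counted as components and not as neighbours of u, so that the
   count makes sense, and is invariant, without acyclicity. *)
Definition live_branch u : pred G := fun x =>
  [&& x != u, ~~ lost (component (off u) x) &
      [exists y, connect (inside (off u)) x y && adj u y]].
Definition nlive u := n_comp (inside (off u)) (live_branch u).
Definition node u := 2 < nlive u.
Definition node_adj u v :=
  (u != v) && connect (inside (fun x => [|| ~~ node x, x == u | x == v])) u v.
Definition live_free : pred G := fun x =>
  ~~ lost (component full x) &&
  [forall y, connect (inside full) x y ==> ~~ node y].
(** Components that survive but contain no node: they give the components of
   the skeleton that consist of a single edge. *)
Definition nfree := n_comp (inside full) live_free.

Lemma inside_sym X : symmetric (inside X).
Proof. by move=> x y; rewrite /inside adj_sym andbCA. Qed.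

Lemma inside_csym X : connect_sym (inside X).
Proof. exact/sym_connect_sym/inside_sym. Qed.

Lemma connect_inside X x y : connect (inside X) x y -> X x -> X y.
Proof.
move=> cxy Xx; elim/connect_ind: y / cxy => // y z _ _.
by case/and3P.
Qed.

Lemma component_eq X x y :
  connect (inside X) x y -> component X x = component X y.
Proof.
by move=> cxy; apply/setP=> z; rewrite !inE (same_connect (inside_csym X) cxy).
Qed.

Lemma live_branch_step u x y :
  inside (off u) x y -> live_branch u x = live_branch u y.
Proof.
move=> t; have c := connect1 t; rewrite /live_branch (component_eq c).
have [xu yu _] := and3P t; rewrite (xu : x != u) (yu : y != u).
congr [&& _, _ & _]; apply: eq_existsb => z.
by rewrite (same_connect (inside_csym _) c).
Qed.

Lemma live_free_step x y : inside full x y -> live_free x = live_free y.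
Proof.
move=> t; have c := connect1 t; rewrite /live_free (component_eq c); congr (_ && _).
by apply: eq_forallb => z; rewrite (same_connect (inside_csym _) c).
Qed.

Lemma eq_inside X Y : X =1 Y -> inside X =2 inside Y.
Proof. by move=> XY x y; rewrite /inside !XY. Qed.

Lemma nlive_le_deg u : nlive u <= #|[set y | adj u y]|.
Proof.
rewrite /nlive.
have le := leq_imset_card (fingraph.root (inside (off u))) [set y | adj u y].
refine (leq_trans _ le).
apply/subset_leq_card/subsetP=> x.
rewrite !inE => /andP[/eqP rx /and3P[_ _ /existsP[y /andP[cxy uy]]]].
apply/imsetP; exists y; first by rewrite !inE.
by rewrite -rx; apply/(fingraph.rootP (inside_csym _)).
Qed.

End Invariants.

Definition same_shape (G H : lgraph) := nfree G = nfree H /\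
  exists f : {u : G | node u} -> {u : H | node u}, [/\ bijective f,
    forall u v, node_adj (val (f u)) (val (f v)) = node_adj (val u) (val v) &
    forall u, nlive (val (f u)) = nlive (val u)].

Lemma same_refl G : same_shape G G.
Proof. by split=> //; exists id; split=> //; exists id. Qed.

Lemma same_sym G H : same_shape G H -> same_shape H G.
Proof.
case=> k [f [[g fK gK] fadj flive]]; split=> //; exists g; split.
- by exists f.
- by move=> u v; rewrite -fadj !gK.
- by move=> u; rewrite -flive gK.
Qed.

Lemma same_trans G H K : same_shape G H -> same_shape H K -> same_shape G K.
Proof.
case=> k [f [bf fadj flive]] [k' [g [bg gadj glive]]].
split; first by rewrite k.
exists (g \o f); split; first exact: bij_comp.
  by move=> u v; rewrite /= gadj fadj.
by move=> u; rewrite /= glive flive.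
Qed.

(** A map h that matches connectedness, negligibility and branches preserves the
   invariants.  The map may miss vertices (blowing-up adds one) and may identify
   vertices (a skeletal map folds an edge onto an isolated vertex); all that is
   needed is that h is injective over the nodes and meets every live component.
   Component counts are transported by an adjunction between the two graphs. *)
Section SameMap.
Variables (G H : lgraph) (h : G -> H).
Definition single x := forall y, h y = h x -> y = x.

Hypothesis h_conn : forall (X : pred H) x y,
  (forall z, z \notin codom h -> X z) ->
  X (h x) -> X (h y) ->
  connect (inside X) (h x) (h y) = connect (@inside G (X \o h)) x y.
Hypothesis h_node : forall v, node v -> exists2 u, h u = v & single u.
Hypothesis node_single : forall u : G, node u -> single u.
Hypothesis h_unit : forall z, ~~ lost (component (@full H) z) ->
  exists x, connect (inside (@full H)) z (h x).
Hypothesis h_unit_off : forall u z, single u -> live_branch (h u) z ->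
  exists x, connect (inside (off (h u))) z (h x).
Hypothesis h_lost : forall (X : pred H) x,
  (forall z, z \notin codom h -> X z) ->
  X (h x) -> lost (component X (h x)) = lost (@component G (X \o h) x).
Hypothesis h_branch : forall u x, single u -> x != u ->
  [exists y, connect (inside (off (h u))) (h x) y && adj (h u) y] =
  [exists y, connect (inside (off u)) x y && adj u y].

Let single_off u x : single u -> off (h u) (h x) = off u x.
Proof.
by move=> su; rewrite /off /=; congr (~~ _); apply/eqP/eqP => [/su|->].
Qed.

Let off_im u z : z \notin codom h -> off (h u) z.
Proof. by apply: contraNneq => ->; apply: codom_f. Qed.

Lemma live_branch_map u x :
  single u -> live_branch (h u) (h x) = live_branch u x.
Proof.
move=> su; rewrite /live_branch /=.
have -> : (h x != h u) = (x != u) by apply: single_off.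
case: (eqVneq x u) => //= xu.
have hxu : off (h u) (h x) by rewrite single_off.
rewrite h_lost //; last exact: off_im.
rewrite h_branch //; congr (~~ lost _ && _).
apply/setP=> z; rewrite !inE; apply/eq_connect/eq_inside => y.
exact: single_off.
Qed.

Lemma nlive_map u : single u -> nlive (h u) = nlive u.
Proof.
move=> su; rewrite /nlive.
rewrite (@adjunction_n_comp _ _ h _ (inside (off u))); first last.
- split=> [z lz|x y lx].
    case: (pickP (fun x => connect (inside (off (h u))) z (h x))) => [x cx|nx].
      by exists x.
    by exfalso; have [x] := h_unit_off su lz; rewrite nx.
  have hx : off (h u) (h x) by case/and3P: lx.
  case: (eqVneq y u) => [->|yu].
    transitivity false; [apply/negP=> c | apply/esym/negP=> c].
      have xu : off u x by rewrite -single_off.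
      by have := connect_inside c xu; rewrite /off eqxx.
    by have := connect_inside c hx; rewrite /off eqxx.
  rewrite h_conn //; first last.
  - by rewrite single_off.
  - exact: off_im.
  by apply/esym/eq_connect/eq_inside => z; apply: single_off.
- by move=> x y t; rewrite !unfold_in; apply: live_branch_step.
- exact: inside_csym.
- exact: inside_csym.
by apply: eq_n_comp_r => x; rewrite !inE; apply: live_branch_map.
Qed.

Lemma node_map u : node (h u) = node u.
Proof.
apply/idP/idP=> nu.
  have [v hv sv] := h_node nu; have uv := sv u (esym hv).
  by rewrite uv /node -nlive_map // -uv.
by rewrite /node nlive_map //; apply: node_single.
Qed.

Lemma live_free_map x : live_free (h x) = live_free x.
Proof.
rewrite /live_free /= h_lost //; congr (~~ lost _ && _).
apply/forallP/forallP=> nn y; apply/implyP=> c.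
  have /implyP := nn (h y); rewrite h_conn // node_map; exact.
apply/negP=> ny; have [u hu _] := h_node ny.
have /implyP := nn u; rewrite -node_map hu ny -(@h_conn (@full H)) // hu.
by move/(_ c).
Qed.

Lemma nfree_map : nfree H = nfree G.
Proof.
rewrite /nfree (@adjunction_n_comp _ _ h _ (inside (@full G))); first last.
- split=> [z lz|x y lx]; last by rewrite h_conn.
  case: (pickP (fun x => connect (inside (@full H)) z (h x))) => [x cx|nx].
    by exists x.
  exfalso; suff [x] : exists x, connect (inside (@full H)) z (h x).
    by rewrite nx.
  by apply: h_unit; case/andP: lz.
- by move=> x y t; rewrite !unfold_in; apply: live_free_step.
- exact: inside_csym.
- exact: inside_csym.
by apply: eq_n_comp_r => x; rewrite !inE; apply: live_free_map.
Qed.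

Lemma same_map : same_shape G H.
Proof.
split; first by rewrite nfree_map.
have hn (u : {u : G | node u}) : node (h (val u)) by rewrite node_map (valP u).
pose f u : {v : H | node v} := exist _ (h (val u)) (hn u).
exists f; split.
- have pre (v : {v : H | node v}) : {u : {u : G | node u} | f u == v}.
    case: (pickP (fun u => f u == v)) => [u fu|nf]; first by exists u.
    exfalso; have [u hu _] := h_node (valP v).
    have nu : node u by rewrite -node_map hu (valP v).
    by have /eqP[] := nf (exist _ u nu); apply: val_inj.
  exists (fun v => sval (pre v)) => [u|v].
    case: (pre (f u)) => /= u' /eqP/(congr1 val) /= eu.
    exact/val_inj/(node_single (valP u)).
  by case: (pre v) => /= u' /eqP.
- move=> u v; rewrite /node_adj /=.
  have su := node_single (valP u); have sv := node_single (valP v).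
  have -> : (h (val u) == h (val v)) = (val u == val v).
    by apply/eqP/eqP => [/sv|->].
  congr (_ && _); rewrite h_conn ?eqxx ?orbT //; last first.
    move=> z nz; apply/orP; left; apply/negP=> /h_node[x hx _].
    by rewrite -hx codom_f in nz.
  apply/eq_connect/eq_inside => x; rewrite /= node_map.
  congr [|| _, _ | _]; first by apply/eqP/eqP => [/su|->].
  by apply/eqP/eqP => [/sv|->].
- by move=> u; rewrite /= nlive_map //; apply/node_single/(valP u).
Qed.
End SameMap.

(** * Invariance under blowing-up *)
(** Here G is the graph H contracted at e.  Since e has at most two neighbours it
   is not a node, so no node is lost, and a branch or component that consists
   of e alone, if there is one, is negligible. *)
Section Contract.
Variables (G H : lgraph) (i : G -> H) (e : H).
Hypotheses (i_inj : injective i) (i_e : forall x, i x != e).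
Hypothesis i_cod : forall y, y != e -> y \in codom i.
Hypothesis adjE : forall x y, adj x y = contract (@adj H) e (i x) (i y).
Hypothesis deg_e : #|[set y | adj e y]| <= 2.
Hypothesis lostE : forall (X : pred H) x, X e -> X (i x) ->
  lost (component X (i x)) = lost (@component G (X \o i) x).
Hypothesis e_full : ~~ lost (component (@full H) e) -> exists z, adj e z.
Hypothesis e_off : forall u, ~~ lost (component (off (i u)) e) ->
  exists2 z, z != i u & adj e z.

Let preim y : y != e -> exists x, y = i x.
Proof. by move/i_cod/codomP. Qed.

(** Contracting a vertex of X preserves connectedness inside X: a passage through
   e becomes an edge between the two neighbours of e, and conversely. *)
Lemma connect_contract (X : pred H) x y : X e -> X (i x) ->
  connect (inside X) (i x) (i y) = connect (@inside G (X \o i)) x y.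
Proof.
move=> Xe Xx; apply/idP/idP=> c.
  (* the invariant of the walk: at e, it has reached a neighbour of e *)
  pose P z := if z == e then
      exists t, adj e (i t) /\ connect (@inside G (X \o i)) x t
    else exists2 t, z = i t & connect (@inside G (X \o i)) x t.
  suff : P (i y) by rewrite /P (negbTE (i_e y)) => -[t /i_inj ->].
  elim/connect_ind: (i y) / c => [|z t cz Pz zt].
    by rewrite /P (negbTE (i_e x)); exists x.
  have [Xz Xt nzt] := and3P zt; rewrite /P.
  case: (eqVneq t e) => [te|te].
    have ze : z != e by apply: contraTneq nzt => ->; rewrite te adj_irr.
    move: Pz; rewrite /P (negbTE ze) => -[z' zz' cz'].
    by exists z'; split=> //; rewrite -zz' adj_sym -te.
  have [t' tt'] := preim te; exists t' => //.
  case: (eqVneq z e) Pz => [ze|ze]; rewrite /P ?ze ?eqxx ?(negbTE ze).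
    case=> s [es cs]; case: (eqVneq s t') => [<- //|st].
    have Xs : X (i s) by apply: (connect_inside cs).
    apply: connect_trans cs (connect1 _).
    rewrite /inside /= Xs -tt' Xt adjE /contract !i_e inj_eq // st.
    by rewrite (adj_sym (i s) e) es -tt' -ze nzt orbT.
  case=> s zs cs; apply: connect_trans cs (connect1 _).
  by rewrite /inside /= -zs -tt' Xz Xt adjE /contract -zs -tt' nzt ze te.
elim/connect_ind: y / c => // y z _ cy /and3P[/= Xy Xz].
rewrite adjE => /and3P[_ _ /orP[nyz|/and3P[_ ye ez]]];
  apply: (connect_trans cy); first by apply: connect1; rewrite /inside Xy Xz.
by apply: (@connect_trans _ _ e); apply: connect1; rewrite /inside ?Xy ?Xz Xe.
Qed.

Lemma e_exit (X : pred H) y : X y -> y != e -> connect (inside X) y e ->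
  exists2 z, X (i z) && adj e (i z) & connect (inside X) y (i z).
Proof.
move=> Xy ye c.
suff : e = e ->
    exists2 z, X (i z) && adj e (i z) & connect (inside X) y (i z) by apply.
elim/connect_ind: {1}e / c => [ye'|z t cz _ zt te].
  by rewrite ye' eqxx in ye.
have [Xz _] := and3P zt; rewrite te => nze.
have ze : z != e by apply: contraTneq nze => ->; rewrite adj_irr.
have [z' zz'] := preim ze; exists z'; rewrite -zz' ?Xz 1?adj_sym //.
Qed.

Lemma same_contract : same_shape G H.
Proof.
have single_i u : single i u by move=> v /i_inj.
have outE (X : pred H) : (forall z, z \notin codom i -> X z) -> X e.
  by apply; apply/negP=> /codomP[x xe]; have := i_e x; rewrite xe eqxx.
apply: (@same_map _ _ i).
- by move=> X x y /outE Xe Xx _; apply: connect_contract.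
- move=> v nv; case: (eqVneq v e) nv => [->|ve nv].
    by rewrite /node ltnNge (leq_trans (nlive_le_deg e) deg_e).
  by have [u ->] := preim ve; exists u.
- by move=> u _; apply: single_i.
- move=> z; case: (eqVneq z e) => [->|ze _]; last first.
    by have [x zx] := preim ze; exists x; rewrite zx connect0.
  move=> /e_full[z' ez'].
  have z'e : z' != e by apply: contraTneq ez' => ->; rewrite adj_irr.
  by have [x xz'] := preim z'e; exists x; apply: connect1; rewrite /inside -xz'.
- move=> u z _; case: (eqVneq z e) => [->|ze _]; last first.
    by have [x zx] := preim ze; exists x; rewrite zx connect0.
  case/and3P=> eu /e_off[z' z'u ez'] _.
  have z'e : z' != e by apply: contraTneq ez' => ->; rewrite adj_irr.
  have [x xz'] := preim z'e; exists x; apply: connect1.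
  by rewrite /inside -xz' ez' /off eu z'u.
- by move=> X x /outE Xe Xx; apply: lostE.
move=> u x _ xu; have offe : off (i u) e by rewrite /off eq_sym i_e.
have offx y : off (i u) (i y) = off u y by rewrite /off inj_eq.
have connE y : connect (inside (off (i u))) (i x) (i y) =
               connect (inside (off u)) x y.
  rewrite connect_contract // ?offx //.
  by apply/eq_connect/eq_inside => z; apply: offx.
apply/existsP/existsP=> -[y /andP[cy uy]].
  case: (eqVneq y e) cy uy => [->|ye] cy uy.
    have offix : off (i u) (i x) by rewrite offx.
    have [z /andP[zu ez] cz] := e_exit offix (i_e x) cy.
    exists z; rewrite -connE cz adjE /contract !i_e uy ez eq_sym.
    by rewrite (zu : _ != _) orbT.
  have [y' yy'] := preim ye; exists y'; rewrite -connE -yy' cy adjE /contract.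
  by rewrite !i_e -yy' uy.
move: uy; rewrite adjE => /and3P[_ _ /orP[uy|/and3P[uy ue ey]]].
  by exists (i y); rewrite connE cy.
exists e; rewrite ue andbT; apply: (@connect_trans _ _ (i y)).
  by rewrite connE.
apply: connect1; rewrite /inside adj_sym ey offe offx /off.
by rewrite -(inj_eq i_inj) eq_sym uy.
Qed.
End Contract.

Definition trivial_lost (T : finType) : pred {set T} := fun D => D == set0.
Definition collapsing (G : wgraph) : lgraph :=
  @LGraph G (dead (@adj G) (@weight G)).
Definition bare (G : graph) : lgraph := @LGraph G (@trivial_lost G).

Definition contraction (G H : graph) (i : G -> H) (e : H) : Prop :=
  [/\ injective i, forall y, y != e <-> y \in codom i,
    forall x y, adj x y = contract (@adj H) e (i x) (i y),
    #|[set y | adj e y]| <= 2 &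
    forall x y, adj e x -> adj e y -> ~~ adj x y].

(** All three kinds of blowing-up are inverse to a single contraction. *)
Lemma blowing_up_contraction (G H : wgraph) : blowing_up G H ->
  exists (i : G -> H) (e : H), [/\ contraction i e,
    forall x, weight x = contract_weight (@adj H) (@weight H) e (i x) &
    weight e = (-1)%R].
Proof.
have main (A : {set G}) : #|A| <= 2 ->
    (forall x y, x \in A -> y \in A -> x != y -> adj x y) ->
    wgraph_iso (blow A) H -> exists (i : G -> H) (e : H), [/\ contraction i e,
    forall x, weight x = contract_weight (@adj H) (@weight H) e (i x) &
    weight e = (-1)%R].
  move=> A2 clique [f [bf fadj fw]]; have f_inj := bij_inj bf.
  pose i x := f (Some x); pose e := f None.
  have ie x : i x != e by rewrite /i /e inj_eq.
  have i_inj : injective i by move=> x y /f_inj [].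
  have cod y : y != e -> exists x, y = i x.
    have [g fK gK] := bf; rewrite -(gK y) /e inj_eq //.
    by case: (g y) => // x _; exists x.
  have adje x : adj e (i x) = (x \in A) by rewrite fadj.
  exists i, e; split; [split|move=> x|]; last by rewrite fw.
  - exact: i_inj.
  - move=> y; split=> [/cod[x ->]|/codomP[x ->]]; [exact: codom_f|exact: ie].
  - move=> x y; rewrite /contract !ie (adj_sym (i x) e) !adje fadj /=.
    rewrite (inj_eq f_inj).
    rewrite -[Some x == Some y]/(x == y).
    case: (boolP (x \in A)) => xA; case: (boolP (y \in A)) => yA /=;
      rewrite ?andbT ?andbF ?orbF //.
    by case: (eqVneq x y) => [->|xy]; rewrite ?adj_irr ?clique.
  - apply: leq_trans A2; rewrite -(card_imset _ i_inj).
    apply/subset_leq_card/subsetP=> y; rewrite inE => ey.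
    have ye : y != e by apply: contraTneq ey => ->; rewrite adj_irr.
    have [x yx] := cod y ye; apply/imsetP; exists x => //.
    by rewrite -adje -yx.
  - move=> x y ex ey.
    have xe : x != e by apply: contraTneq ex => ->; rewrite adj_irr.
    have ye : y != e by apply: contraTneq ey => ->; rewrite adj_irr.
    have [x' xx'] := cod x xe; have [y' yy'] := cod y ye.
    move: ex ey; rewrite xx' yy' !adje fadj /= => -> ->.
    by rewrite andbF.
  - by rewrite /contract_weight adje fw /= GRing.subrK.
case=> [v|v1 v2 adj12|]; apply: main.
- by rewrite cards1.
- by move=> x y /set1P-> /set1P->; rewrite eqxx.
- by rewrite cards2; case: (_ == _).
- move=> x y /set2P[]-> /set2P[]->; rewrite ?eqxx // 1?adj_sym //.
- by rewrite cards0.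
- by move=> x y; rewrite inE.
Qed.

(** By confluence, a component is dead in H exactly when what remains of it after
   the contraction at e is dead in G. *)
Lemma contraction_same (G H : wgraph) (i : G -> H) (e : H) :
  contraction i e ->
  (forall x, weight x = contract_weight (@adj H) (@weight H) e (i x)) ->
  weight e = (-1)%R -> same_shape (collapsing G) (collapsing H).
Proof.
case=> i_inj i_cod adjE deg_e nadj wE we.
have ce : collapsible (@adj H) (@weight H) e by rewrite /collapsible we eqxx.
have ie x : i x != e by apply/i_cod/codom_f.
have component_e (X : pred H) : X e ->
    ~~ dead (@adj H) (@weight H) (@component (collapsing H) X e) ->
    exists2 z, X z & adj e z.
  move=> Xe nd; case: (pickP (fun z => X z && adj e z)) => [z /andP[]|nz].
    by exists z.
  case/negP: nd; suff -> : @component (collapsing H) X e = [set e].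
    exact: dead1.
  apply/setP=> z; rewrite !inE; apply/idP/eqP=> [c|->//].
  elim/connect_ind: z / c => // y z _ -> /and3P[_ Xz ez].
  by have := nz z; rewrite Xz; rewrite [adj e z]ez.
apply: (@same_contract (collapsing G) (collapsing H) i e) => //.
- by move=> y /i_cod.
- move=> X x Xe Xx /=.
  rewrite (@dead_contract _ _ _ _ e) //; first last.
  + have [eC|eC] := boolP (e \in @component (collapsing H) X (i x)).
      by left.
    right.
    split=> // y yC; apply: contra eC => ey; rewrite inE; rewrite inE in yC.
    apply: (connect_trans yC); apply: connect1.
    have Xy := connect_inside yC Xx.
    by rewrite /inside Xy Xe /= adj_sym.
  + exact: adj_sym.
  rewrite (@dead_map _ _ i _ _ (@adj G) (@weight G)) //; first last.
  + by apply/subsetP=> y /setD1P[ye _]; apply/i_cod.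
  + by move=> x' y /and3P[_ ye _]; apply/i_cod.
  congr dead; apply/setP=> y; rewrite !inE ie /=.
  by rewrite (@connect_contract (collapsing G) (collapsing H) i e) // => z /i_cod.
- move=> nd; have [//|z _] := component_e (@full (collapsing H)) _ nd.
  by exists z.
- by move=> u; apply: component_e; rewrite /off eq_sym ie.
Qed.

Lemma wequiv_same G H : wequiv G H -> same_shape (collapsing G) (collapsing H).
Proof.
elim=> {G H} [G H|G|G H _|G H K _ sGH _].
- case/blowing_up_contraction=> i [e [contr_i wi we]].
  exact: contraction_same contr_i wi we.
- exact: same_refl.
- exact: same_sym.
- exact: same_trans.
Qed.

(** * Forests stay forests *)
(** Acyclicity expressed by subsets instead of cycles: it is much easier to
   follow through a contraction, where a cycle would have to be rerouted. *)
Definition one_degenerate (G : graph) := forall X : {set G}, X != set0 ->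
  exists2 x, x \in X & #|[set y in X | adj x y]| <= 1.

(** If every vertex of X had two neighbours in X, a simple path in X could always
   be prolonged without turning back; a return to the path would close a cycle,
   and otherwise the path would outgrow the graph. *)
Lemma forest_degenerate (G : graph) : forest G -> one_degenerate G.
Proof.
move=> fG X /set0Pn[x0 x0X]; apply/exists_inP; apply: contraT.
rewrite negb_exists_in => /forall_inP deg2.
have long n : exists x p,
    [/\ size p = n, uniq (x :: p), path (@adj G) x p & {subset x :: p <= X}].
  elim: n => [|n [x [p [sp up pp pX]]]].
    by exists x0, [::]; split=> // y; rewrite inE => /eqP->.
  have xX : x \in X by apply: pX; rewrite mem_head.
  have [z zX [xz zp]] : exists2 z, z \in X & adj x z /\ z != head x p.
    have := deg2 x xX; rewrite -ltnNge => /card_gt1P[y [z [yX zX yz]]].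
    move: yX zX; rewrite !inE => /andP[yX xy] /andP[zX xz].
    case: (eqVneq z (head x p)) => [zp|]; last by exists z.
    by exists y => //; split; rewrite -?zp.
  case: (boolP (z \in x :: p)) => zin; last first.
    exists z, (x :: p); split=> //=; rewrite ?sp ?zin ?(adj_sym z) ?xz //.
    by move=> y; rewrite inE => /predU1P[-> //|/pX].
  have {}zin : z \in p.
    by move: zin; rewrite inE; case: eqP xz => // ->; rewrite adj_irr.
  case/splitPr: p / zin sp up pp pX zp => p1 p2 sp up pp pX zp.
  have /fG : ucycle (@adj G) (x :: rcons p1 z).
    rewrite /ucycle /cycle /= rcons_path last_rcons (adj_sym z) xz andbT.
    rewrite -cat_rcons in pp up.
    move: pp up; rewrite cat_path -cat_cons cat_uniq => /andP[-> _] /andP[] //.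
  by case: p1 {sp up pp pX} zp => [|y p1] /=; rewrite ?eqxx // size_rcons.
have [x [p [sp up _ _]]] := long #|G|.
have := card_uniqP up; rewrite /= sp => cp.
by have := max_card (mem (x :: p)); rewrite cp ltnn.
Qed.

(** Each vertex of a cycle has two neighbours in the cycle. *)
Lemma degenerate_forest (G : graph) : one_degenerate G -> forest G.
Proof.
move=> dG c /andP[cc uc]; rewrite ltnNge; apply/negP=> c3.
have [|x] := dG [set x in c].
  by case: c c3 {cc uc} => // x c _; apply/set0Pn; exists x; rewrite inE mem_head.
rewrite inE => xc; have [i c' def_c] := rot_to xc.
rewrite leqNgt => /negP[]; apply/card_gt1P.
have : cycle (@adj G) (x :: c') by rewrite -def_c rot_cycle.
have : uniq (x :: c') by rewrite -def_c rot_uniq.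
have c'c : {subset c' <= c}.
  by move=> y yc'; rewrite -(mem_rot i) def_c inE yc' orbT.
have : 2 < size (x :: c') by rewrite -def_c size_rot.
case/lastP: c' c'c {def_c} => // -[//|y c'] z c'c _.
rewrite /= rcons_path last_rcons => /and3P[_ yz _] /andP[xy /andP[_ zx]].
exists y, z; split; rewrite ?inE ?xy 1?adj_sym ?zx ?andbT.
- by apply: c'c; rewrite mem_head.
- by apply: c'c; rewrite mem_rcons !inE eqxx.
by apply: contraNneq yz => ->; rewrite mem_rcons mem_head.
Qed.

Section ContractForest.
Variables (G H : graph) (i : G -> H) (e : H).
Hypothesis contr_i : contraction i e.

(** A set X of vertices of G that contains both neighbours of e is compared with
   X + e in H, any other X with X itself. *)
Lemma contraction_degenerate : one_degenerate H -> one_degenerate G.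
Proof.
have [i_inj i_cod adjE deg_e nadj] := contr_i; move=> dH X X0.
have ie x : i x != e by apply/i_cod/codom_f.
have bound (Y : {set H}) x : (forall y, y \in X -> i y \in Y) ->
    (forall y, y \in X -> adj x y -> adj (i x) (i y)) ->
    #|[set y in Y | adj (i x) y]| <= 1 -> #|[set y in X | adj x y]| <= 1.
  move=> XY aX; apply: leq_trans; rewrite -(card_imset _ i_inj).
  apply/subset_leq_card/subsetP=> _ /imsetP[y /[!inE] /andP[yX xy] ->].
  by rewrite XY // aX.
case: (boolP [exists p in X, exists q in X,
               [&& p != q, adj e (i p) & adj e (i q)]]).
  case/exists_inP=> p pX /exists_inP[q qX /and3P[pq ep eq]].
  have [|y0] := dH (e |: i @: X).
    by apply/set0Pn; exists e; rewrite setU11.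
  rewrite in_setU1 => /predU1P[->|/imsetP[x xX ->] degx].
    rewrite leqNgt => /negP[]; apply/card_gt1P; exists (i p), (i q).
    by rewrite !inE !imset_f ?orbT // ep eq inj_eq.
  exists x => //; rewrite leqNgt; apply: contraL degx; rewrite -ltnNge.
  case/card_gt1P=> y [z [/[!inE] /andP[yX xy] /andP[zX xz] yz]].
  (* in H, a neighbour of x created by the contraction is replaced by e *)
  pose g t := if adj (i x) (i t) then i t else e.
  apply/card_gt1P; exists (g y), (g z).
  have gin t : t \in X -> adj x t -> (g t \in e |: i @: X) && adj (i x) (g t).
    rewrite /g => tX; case: ifP => [-> _|nxt].
      by rewrite !inE imset_f // orbT.
    by rewrite adjE /contract nxt !ie /= setU11 => /and3P[].
  split; [by rewrite inE gin | by rewrite inE gin | rewrite /g].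
  case: ifP => ny; case: ifP => nz; rewrite ?inj_eq //.
    by rewrite eq_sym.
  move: xy xz; rewrite !adjE /contract ny nz !ie /=.
  move=> /and3P[xy xe ey] /and3P[xz _ ez].
  (* two created neighbours would make x, y, z three neighbours of e *)
  suff le3 : #|i x |: [set i y; i z]| <= #|[set y | adj e y]|.
    have := leq_trans le3 deg_e.
    by rewrite cardsU1 !inE negb_or xy xz cards2 (inj_eq i_inj) yz.
  apply/subset_leq_card/subsetP=> t; rewrite !inE.
  by case/or3P=> /eqP-> //; rewrite adj_sym.
rewrite negb_exists_in => /forall_inP one.
have [|y0] := dH (i @: X).
  by have /set0Pn[x xX] := X0; apply/set0Pn; exists (i x); rewrite imset_f.
case/imsetP=> x xX -> degx; exists x => //.
apply: bound degx => y yX; first exact: imset_f.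
rewrite adjE => /and3P[_ _ /orP[//|/and3P[xy xe ey]]].
have := one x xX; rewrite negb_exists_in => /forall_inP/(_ y yX).
by rewrite (inj_eq i_inj) in xy; rewrite xy adj_sym xe ey.
Qed.

(** If e has two neighbours in X, then the degree of a vertex in X - e taken in G
   bounds its degree in X taken in H: a neighbour e is replaced by the other
   neighbour of e. *)
Lemma expansion_degenerate : one_degenerate G -> one_degenerate H.
Proof.
have [i_inj i_cod adjE deg_e nadj] := contr_i; move=> dG X X0.
have ie x : i x != e by apply/i_cod/codom_f.
case: (leqP #|[set y in X | adj e y]| 1) => [e1|e2].
  case: (boolP (e \in X)) => eX; first by exists e.
  have [|x] := dG (i @^-1: X).
    have /set0Pn[y yX] := X0.
    have ye : y != e by apply: contraNneq eX => <-.
    have /i_cod/codomP[x yx] := ye.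
    by apply/set0Pn; exists x; rewrite inE -yx.
  rewrite inE => xX; set Y := [set _ | _] => Y1; exists (i x) => //.
  apply: leq_trans Y1; rewrite -(card_imset _ i_inj).
  apply/subset_leq_card/subsetP=> y /[!inE] /andP[yX xy].
  have ye : y != e by apply: contraNneq eX => <-.
  have /i_cod/codomP[z yz] := ye; rewrite yz; apply: imset_f.
  by rewrite !inE -yz yX adjE /contract !ie -yz xy.
have nbrX y : adj e y -> y \in X.
  have sub : [set y in X | adj e y] \subset [set y | adj e y].
    by apply/subsetP=> z /[!inE] /andP[].
  have /eqP/setP/(_ y) : [set y in X | adj e y] == [set y | adj e y].
    by rewrite eqEcard sub (leq_trans deg_e).
  by rewrite !inE => + ey; rewrite ey andbT.
have [|x] := dG (i @^-1: X).
  have /card_gt1P[y [_ [/[!inE] /andP[yX ey] _ _]]] := e2.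
  have ye : y != e by apply: contraTneq ey => ->; rewrite adj_irr.
  have /i_cod/codomP[x yx] := ye.
  by apply/set0Pn; exists x; rewrite inE -yx.
rewrite inE => xX Y1; exists (i x) => //.
rewrite leqNgt; apply: contraL Y1; rewrite -ltnNge.
case/card_gt1P=> y [z [/[!inE] /andP[yX xy] /andP[zX xz] yz]].
have common y' z' : y' \in X -> z' \in X -> adj (i x) y' -> adj (i x) z' ->
    y' != z' -> y' != e ->
    exists s, exists t, [/\ s \in [set y in i @^-1: X | adj x y],
                           t \in [set y in i @^-1: X | adj x y] & s != t].
  move=> {yX zX xy xz yz}y'X z'X xy xz yz y'e.
  have /i_cod/codomP[s ys] := y'e.
  have xs : adj x s by rewrite adjE /contract !ie -ys xy.
  case: (eqVneq z' e) => [ze|z'e]; last first.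
    have /i_cod/codomP[t zt] := z'e.
    exists s, t; rewrite !inE -ys -zt y'X z'X xs adjE /contract !ie -zt xz.
    by split=> //; apply: contraNneq yz => st; rewrite ys zt st.
  move: xz; rewrite ze => xe.
  have [w ew wx] : exists2 w, adj e w & w != i x.
    have /card_gt1P[p [q [/[!inE] /andP[_ ep] /andP[_ eq] pq]]] := e2.
    case: (eqVneq p (i x)) => [px|]; last by exists p.
    by exists q => //; rewrite -px eq_sym.
  have we : w != e by apply: contraTneq ew => ->; rewrite adj_irr.
  have /i_cod/codomP[t wt] := we.
  exists s, t; rewrite !inE -ys -wt y'X (nbrX w ew) xs adjE /contract !ie.
  rewrite -wt xe ew.
  rewrite eq_sym wx !orbT; split=> //; apply: contraTneq xy => st.
  by rewrite ys st -wt; apply: nadj; rewrite // adj_sym.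
apply/card_gt1P; case: (eqVneq y e) => [ye|]; last by apply: (common y z).
by apply: (common z y) => //; rewrite eq_sym // -ye.
Qed.
End ContractForest.

Lemma wequiv_degenerate G H : wequiv G H -> one_degenerate G <-> one_degenerate H.
Proof.
elim=> {G H} [G H|G|G H _|G H K _ [GH HG] _ [HK KH]].
- case/blowing_up_contraction=> i [e [contr_i _ _]].
  split; [exact: expansion_degenerate contr_i|].
  exact: contraction_degenerate contr_i.
- by [].
- by case.
- by split=> [/GH|/KH].
Qed.

Lemma wequiv_forest G H : wequiv G H -> forest G -> forest H.
Proof.
move=> /wequiv_degenerate GH /forest_degenerate/GH.
exact: degenerate_forest.
Qed.

(** * A skeleton is determined by its nodes *)
(** In a forest distinct neighbours of u lie in distinct branches, since a path
   between them avoiding u would close a cycle through u. *)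
Lemma nlive_bare (G : graph) (u : G) : forest G -> nlive (u : bare G) = deg u.
Proof.
move=> fG; apply/eqP; rewrite eqn_leq (nlive_le_deg (u : bare G)) /=.
set e := inside (off (u : bare G)).
have r_inj : {in [set y | adj u y] &, injective (fingraph.root e)}.
  move=> b b' /[!inE] ub ub' /(fingraph.rootP (inside_csym _)).
  case/connectP=> p0 p0e lp0; case: (shortenP p0e) lp0 => p ep up _ lp {p0 p0e}.
  apply/eqP; apply: contraT => bb'.
  have pe : path (@adj G) b p by apply: sub_path ep => x y /and3P[].
  have up' : u \notin b :: p.
    rewrite inE negb_or; apply/andP; split.
      by apply: contraTneq ub => <-; rewrite adj_irr.
    apply/negP=> upp; have cu : connect e b u.
      by apply: (path_connect ep); rewrite inE upp orbT.
    have bu : b != u by apply: contraTneq ub => ->; rewrite adj_irr.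
    by have := connect_inside cu bu; rewrite /off eqxx.
  have /fG : ucycle (@adj G) (u :: b :: p).
    rewrite /ucycle /cycle cons_uniq up' up /= ub rcons_path pe -lp.
    by rewrite adj_sym ub'.
  by case: p lp {ep up pe up'} bb' => [/= -> /eqP|].
rewrite /deg -(card_in_imset r_inj); apply/subset_leq_card/subsetP=> x.
case/imsetP=> b /[!inE] ub ->; rewrite roots_root; last exact: inside_csym.
rewrite /= -/e; set r := fingraph.root e b.
have cbr : connect e b r by apply: connect_root.
have bu : b != u by apply: contraTneq ub => ->; rewrite adj_irr.
have ru : off (u : bare G) r by apply: connect_inside cbr bu.
rewrite unfold_in; apply/and3P; split=> //.
  by apply/set0Pn; exists r; rewrite inE connect0.
by apply/existsP; exists b; rewrite -(inside_csym (G := bare G)) cbr.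
Qed.

(** Each fibre of f is sent to the fibre of g over the same point by matching the
   enumerations of the two fibres. *)
Lemma fiber_injection (X Y : finType) (Z : eqType) (f : X -> Z) (g : Y -> Z) :
  (forall z, #|[set x | f x == z]| = #|[set y | g y == z]|) ->
  exists2 h : X -> Y, injective h & forall x, g (h x) = f x.
Proof.
move=> fg.
have fibX x : x \in enum [set x' | f x' == f x] by rewrite mem_enum inE.
have lt_idx x : index x (enum [set x' | f x' == f x]) <
                size (enum [set y | g y == f x]).
  by rewrite -cardE -fg cardE index_mem.
have y0 (x : X) : Y.
  by have := lt_idx x; case: (enum [set y | g y == f x]) => // y.
pose h x := nth (y0 x) (enum [set y | g y == f x])
                (index x (enum [set x' | f x' == f x])).
have gh x : g (h x) = f x.
  by have := mem_nth (y0 x) (lt_idx x); rewrite mem_enum inE => /eqP.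
exists h => // x x' hxx'.
have fxx' : f x = f x' by rewrite -gh hxx' gh.
move: hxx' (lt_idx x) (lt_idx x') (fibX x) (fibX x'); rewrite /h -fxx'.
move=> hxx' lx lx' inx inx'.
rewrite (set_nth_default (y0 x) _ lx') in hxx'.
move/eqP: hxx'; rewrite nth_uniq ?enum_uniq // => /eqP exx'.
by rewrite -(nth_index x inx) exx' nth_index.
Qed.

Lemma fiber_bijection (X Y : finType) (Z : eqType) (f : X -> Z) (g : Y -> Z) :
  (forall z, #|[set x | f x == z]| = #|[set y | g y == z]|) ->
  exists2 h : X -> Y, bijective h & forall x, g (h x) = f x.
Proof.
move=> fg; have [h h_inj gh] := fiber_injection fg; exists h => //.
have [|h' h'_inj _] := @fiber_injection Y X Z g f; first by move=> z; rewrite fg.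
by apply: inj_card_bij => //; apply: leq_card h'_inj.
Qed.

Section Skeleton.
Variable S : graph.
Hypothesis skS : skeleton S.
Local Notation bS := (bare S).
Local Notation node := (@node bS).
Implicit Types x y u v : S.
Definition hub := {u : bS | node u}.

Lemma node_deg u : node u = (2 < deg u).
Proof. by rewrite -[node u]/(2 < nlive (u : bS)) nlive_bare //; case: skS. Qed.

Lemma leaf_deg x : ~~ node x -> deg x = 1.
Proof.
rewrite node_deg -leqNgt; have [_ /(_ x)[]] := skS.
by case: (deg x) => [|[|[]]].
Qed.

Definition stem x : S := odflt x [pick y | adj x y].

Lemma adj_stem x y : ~~ node x -> adj x y = (y == stem x).
Proof.
move/leaf_deg/eqP/cards1P=> [z /setP xz].
have {}xz t : adj x t = (t == z) by have := xz t; rewrite !inE.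
rewrite /stem; case: pickP => [t /[!xz]/eqP->//|/(_ z)]; rewrite xz ?eqxx //.
Qed.

Lemma stem_stem x : ~~ node x -> ~~ node (stem x) -> stem (stem x) = x.
Proof. by move=> nx ns; apply/esym/eqP; rewrite -adj_stem // adj_sym adj_stem. Qed.

Lemma stem_neq x : ~~ node x -> x != stem x.
Proof. by move=> nx; rewrite -adj_stem // adj_irr. Qed.

(** Vertices other than nodes are leaves, hence no path goes through them. *)
Lemma node_adj_skeleton u v : node_adj (u : bS) v = adj u v.
Proof.
rewrite /node_adj; case: eqVneq => [->|uv]; first by rewrite adj_irr.
apply/idP/idP=> [c|auv]; last by apply: connect1; rewrite /inside !eqxx !orbT.
pose P z := adj u v \/ z = u \/ ~~ node z /\ adj u z.
have : P v.
  apply: (@connect_ind _ _ P u _ _ v c); first by right; left.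
  move=> y z _ Py /and3P[_ Xz yz].
  case: Py => [|Py]; first by left.
  case/or3P: Xz => [nz|/eqP->|/eqP zv]; [|by right; left|].
    case: Py => [yu|[ny uy]]; first by right; right; rewrite -yu.
    right; left; apply/eqP; rewrite [in X in X == _](eqP (_ : z == stem y)).
      by rewrite eq_sym -adj_stem // adj_sym.
    by rewrite -adj_stem.
  case: Py => [yu|[ny uy]]; first by left; rewrite -yu -zv.
  move: yz uy; rewrite zv (adj_sym u) [adj _ _]adj_stem // adj_stem //.
  move=> /eqP vs /eqP us.
  by rewrite vs us eqxx in uv.
by case=> [//|[vu|[]//]]; rewrite vu eqxx in uv.
Qed.

Definition free_roots : seq S :=
  enum [pred r : bS | fingraph.roots (inside (@full bS)) r & live_free r].

(** Each vertex of a skeleton gets a code in a type that depends only on the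
   invariants: a node is coded by itself, a leaf at a node by this node, and
   the two ends of an isolated edge by the index of this component.  Adjacency can
   be read off from the codes, and the number of vertices with a given code is
   an invariant, so skeletons with the same invariants are isomorphic. *)
Definition code x : hub + hub + nat :=
  if insub x is Some t then inl (inl t)
  else if insub (stem x) is Some t then inl (inr t)
  else inr (index (fingraph.root (inside (@full bS)) x) free_roots).

Definition code_adj (c d : hub + hub + nat) : bool :=
  match c, d with
  | inl (inl t), inl (inl t') => node_adj (val t) (val t')
  | inl (inl t), inl (inr t') | inl (inr t), inl (inl t') => t == t'
  | inr n, inr m => n == m
  | _, _ => false
  end.

Variant code_spec x : hub + hub + nat -> Type :=
  | CodeNode t of val t = x & node x : code_spec x (inl (inl t))
  | CodeLeaf t of val t = stem x & ~~ node x : code_spec x (inl (inr t))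
  | CodeFree of ~~ node x & ~~ node (stem x) :
      code_spec x (inr (index (fingraph.root (inside (@full bS)) x) free_roots)).

Lemma codeP x : code_spec x (code x).
Proof.
rewrite /code; case: insubP => [t nx tx|nx]; first exact: CodeNode.
by case: insubP => [t ns ts|ns]; [exact: CodeLeaf|exact: CodeFree].
Qed.

Lemma free_conn x y : ~~ node x -> ~~ node (stem x) ->
  connect (inside (@full bS)) x y = (y \in [set x; stem x]).
Proof.
move=> nx ns; apply/idP/set2P=> [c|[]->]; last first.
- apply: connect1; rewrite /inside /=.
  by have := adj_stem (stem x) nx; rewrite eqxx.
- exact: connect0.
elim/connect_ind: y / c => [|y z _ Py /and3P[_ _ /= yz]]; first by left.
move: Py yz => [->|->]; rewrite adj_stem // => /eqP->; [by right|].
by left; rewrite stem_stem.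
Qed.

Lemma comp_root_eq x y :
  (fingraph.root (inside (@full bS)) x == fingraph.root (inside (@full bS)) y) =
  connect (inside (@full bS)) x y.
Proof. exact: root_connect (inside_csym (G := bS) _) _ _. Qed.

Lemma free_root x : ~~ node x -> ~~ node (stem x) ->
  fingraph.root (inside (@full bS)) x \in free_roots.
Proof.
move=> nx ns; rewrite mem_enum; apply/andP; split.
  exact/roots_root/inside_csym.
have crx := connect_root (inside (@full bS)) x.
apply/andP; split.
  apply/set0Pn; exists (fingraph.root (inside (@full bS)) x).
  by rewrite inE connect0.
apply/forallP=> y; apply/implyP=> cy.
have : connect (inside (@full bS)) x y := connect_trans crx cy.
by rewrite free_conn // => /set2P[]->.
Qed.

Lemma code_adjE x y : adj x y = (x != y) && code_adj (code x) (code y).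
Proof.
case: (eqVneq x y) => [->|xy]; first by rewrite adj_irr.
case: (codeP x) => [t tx nx|t tx nx|nx nsx];
  case: (codeP y) => [t' ty ny|t' ty ny|ny nsy] /=.
- by rewrite tx ty node_adj_skeleton.
- by rewrite adj_sym adj_stem // -tx -ty.
- rewrite adj_sym adj_stem //; apply/eqP=> xs; by rewrite -xs nx in nsy.
- by rewrite adj_stem // -tx -ty eq_sym.
- rewrite adj_stem //; apply/eqP=> ys; have := valP t; rewrite tx -ys.
  by rewrite (negbTE ny).
- rewrite adj_stem //; apply/eqP=> ys; have := valP t; rewrite tx -ys.
  by rewrite (negbTE ny).
- by rewrite adj_stem //; apply/eqP=> ys; rewrite -ys ny in nsx.
- rewrite adj_sym adj_stem //; apply/eqP=> ys; have := valP t'; rewrite ty -ys.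
  by rewrite (negbTE nx).
have rs := free_root nx nsx; have rs' := free_root ny nsy.
rewrite adj_stem //; apply/eqP/eqP=> [ys|ei].
  by congr index; apply/eqP; rewrite comp_root_eq free_conn // ys set22.
have : fingraph.root (inside (@full bS)) x ==
       fingraph.root (inside (@full bS)) y.
  by rewrite -(nth_index x rs) ei nth_index.
rewrite comp_root_eq free_conn // => /set2P[yx|//].
by rewrite yx eqxx in xy.
Qed.

Lemma card_code_node t : #|[set x | code x == inl (inl t)]| = 1.
Proof.
rewrite -(cards1 (val t)); apply: eq_card => x; rewrite !inE.
case: codeP => [t' tx _|t' tx nx|nx _].
- by rewrite -tx; apply/eqP/eqP => [[->]|/val_inj->].
- by apply/esym/eqP=> xt; rewrite xt (valP t) in nx.
- by apply/esym/eqP=> xt; rewrite xt (valP t) in nx.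
Qed.

(** The neighbours of a node are nodes or leaves. *)
Lemma card_code_leaf t :
  #|[set x | code x == inl (inr t)]| +
  #|[set t' : hub | node_adj (val t) (val t')]| = nlive (val t).
Proof.
rewrite nlive_bare; last by case: skS.
rewrite -(card_imset _ val_inj) /deg.
rewrite -(cardsID [set y | node y] [set y | adj (val t) y]) addnC; congr (_ + _).
  apply: eq_card => x; rewrite !inE; apply/imsetP/andP=> [[t' /[!inE]]|[tx nx]].
    by rewrite node_adj_skeleton => a ->; split; rewrite ?(valP t').
  by exists (exist _ x nx) => //; rewrite inE node_adj_skeleton.
apply: eq_card => x; rewrite !inE.
case: codeP => [t' tx nx|t' tx nx|nx ns]; rewrite ?nx //=.
  rewrite adj_sym adj_stem // -tx; apply/eqP/eqP=> [[->//]|/val_inj->//].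
rewrite adj_sym adj_stem //; apply/esym/eqP=> ts.
by rewrite -ts (valP t) in ns.
Qed.

Lemma card_code_free n :
  #|[set x | code x == inr n]| = if n < nfree bS then 2 else 0.
Proof.
have -> : nfree bS = size free_roots by rewrite /nfree -cardE.
case: ltnP => [ln|ge]; last first.
  apply/eqP; rewrite cards_eq0; apply/eqP/setP=> x; rewrite !inE.
  case: codeP => // nx ns; apply/eqP=> -[en].
  by move: ge; rewrite -en leqNgt index_mem free_root.
have x0 : S by case: free_roots ln => // x.
pose r := nth x0 free_roots n.
have rr : r \in free_roots by apply: mem_nth.
have := rr; rewrite mem_enum inE => /andP[/eqP rootr /andP[_ /forallP nn]].
have nr : ~~ node r by have /implyP := nn r; apply; apply: connect0.
have ns : ~~ node (stem r).
  have /implyP := nn (stem r); apply; apply: connect1; rewrite /inside /=.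
  by have := adj_stem (stem r) nr; rewrite eqxx.
have -> : [set x | code x == inr n] = [set r; stem r].
  apply/setP=> x; rewrite inE -free_conn //.
  have -> : connect (inside (@full bS)) r x =
            (fingraph.root (inside (@full bS)) x == r).
    by rewrite -{2}rootr eq_sym comp_root_eq.
  apply/idP/idP => [|/eqP rx].
    case: codeP => // nx nsx /eqP[en].
    by rewrite -(nth_index x0 (free_root nx nsx)) en.
  have cx : connect (inside (@full bS)) r x.
    by rewrite -comp_root_eq rx rootr.
  have [nx nsx] : ~~ node x /\ ~~ node (stem x).
    by move: cx; rewrite free_conn // => /set2P[]->; rewrite ?stem_stem.
  case: codeP nx nsx => [t _ ->//|t ts _ _|_ _ _ _].
    by rewrite -ts (valP t).
  by rewrite rx /r index_uniq ?enum_uniq.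
by rewrite cards2 stem_neq.
Qed.
End Skeleton.

Lemma same_skeleton_iso (S S' : graph) : skeleton S -> skeleton S' ->
  same_shape (bare S) (bare S') -> graph_iso S S'.
Proof.
move=> skS skS' [ek [f [bf fadj flive]]]; have f_inj := bij_inj bf.
pose fcode (c : hub S + hub S + nat) : hub S' + hub S' + nat :=
  match c with
  | inl (inl t) => inl (inl (f t))
  | inl (inr t) => inl (inr (f t))
  | inr n => inr n
  end.
have fcode_inj : injective fcode.
  by move=> [[t|t]|n] [[t'|t']|n'] //= [] => [/f_inj->|/f_inj->|->].
have [|h bh ch] := @fiber_bijection S S' _ (fcode \o @code S) (@code S').
  move=> c'; have [c ->] : exists c, c' = fcode c.
    have [g fK gK] := bf; case: c' => [[t|t]|n].
    - by exists (inl (inl (g t))); rewrite /= gK.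
    - by exists (inl (inr (g t))); rewrite /= gK.
    - by exists (inr n).
  have -> : #|[set x | (fcode \o @code S) x == fcode c]| =
            #|[set x | code x == c]|.
    by apply: eq_card => x; rewrite !inE /= inj_eq.
  case: c => [[t|t]|n] /=; rewrite ?card_code_node ?card_code_free ?ek //.
  apply/eqP.
  rewrite -(eqn_add2r #|[set t' : hub S | node_adj (val t) (val t')]|).
  rewrite card_code_leaf // -flive -card_code_leaf // eqn_add2l.
  rewrite -(card_imset _ f_inj); apply/eqP/eq_card => t'; rewrite inE.
  have [g fK gK] := bf; apply/idP/imsetP=> [a|[t'' /[!inE] a ->]].
    by exists (g t'); rewrite ?gK // inE -fadj gK.
  by rewrite fadj.
exists h => // x y; rewrite !code_adjE // (inj_eq (bij_inj bh)) !ch /=.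
congr (_ && _); case: (code x) (code y) => [[t|t]|n] [[t'|t']|n'] //=.
- by rewrite fadj.
- by rewrite (inj_eq f_inj).
- by rewrite (inj_eq f_inj).
Qed.

(** * Minimal forests and smoothing at a vertex of degree 2 *)
Lemma forest_no_triangle (G : graph) (x y z : G) : forest G ->
  adj x y -> adj x z -> ~~ adj y z.
Proof.
move=> fG xy xz; apply/negP=> yz.
have ne (u v : G) : adj u v -> u != v by apply: contraTneq => ->; rewrite adj_irr.
have /fG : ucycle (@adj G) [:: x; y; z].
  by rewrite /ucycle /cycle /= xy yz adj_sym xz !inE negb_or !ne.
by [].
Qed.

(** In a minimal forest no nonempty set is dead, since the first vertex to be
   contracted would be contractible. *)
Lemma minimal_same (G : wgraph) : forest G -> minimal G ->
  same_shape (collapsing G) (bare G).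
Proof.
move=> fG mG.
have nd (D : {set G}) : D != set0 -> ~~ dead (@adj G) (@weight G) D.
  move=> D0; apply/negP=> /(dead_collapsible D0)[e _ /andP[/eqP we de]].
  by case: (mG e); split=> // x y ex ey _; apply: (forest_no_triangle fG ex).
have component0 (X : pred G) x : @component (bare G) X x != set0.
  by apply/set0Pn; exists x; rewrite inE connect0.
apply: (@same_map (collapsing G) (bare G) id) => //.
- by move=> v _; exists v => // y.
- by move=> u _ v.
- by move=> z _; exists z; apply: connect0.
- by move=> u z _ _; exists z; apply: connect0.
- move=> X x _ _; rewrite /= /trivial_lost (negbTE (nd _ (component0 X x))).
  by rewrite (negbTE (component0 X x)).
Qed.

(** Membership replaces the positions of the sequence: this form is insensitive
   to the insertion and removal of vertices of degree 2. *)
Lemma in_PE (G : graph) x (s : seq G) : in_P (x :: s) <->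
  [/\ uniq (x :: s), path (@adj G) x s,
      {in x :: s, forall y, (deg y != 2) = (y == x) || (y == last x s)} &
      s = [::] -> deg x = 0].
Proof.
case: s => [|y s].
  split=> [/= d0|[_ _ _]]; last exact.
  by split=> // z; rewrite inE => /eqP->; rewrite d0 eqxx.
have ends j : uniq (x :: y :: s) -> j < size (x :: y :: s) ->
    (nth x [:: x, y & s] j == x) || (nth x [:: x, y & s] j == last x (y :: s)) =
    (j == 0) || (j == size (y :: s)).
  have -> : last x (y :: s) = nth x [:: x, y & s] (size (y :: s)).
    by rewrite -nth_last.
  move=> us ltj; congr (_ || _); last by rewrite nth_uniq.
  exact: (@nth_uniq _ x [:: x, y & s] j 0).
split=> [[us ps ds]|[us ps ds _]]; split=> //.
  by move=> z /(nthP x)[j ltj <-]; rewrite ds // ends.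
by move=> j lej; rewrite ds ?mem_nth // ends.
Qed.

(** Smoothing deletes a vertex e of degree 2 and joins its two neighbours.  It
   changes neither the skeletons nor the invariants, so that skeletons need only
   be studied for forests without vertices of degree 2. *)
Section Smooth.
Variables (G : graph) (e : G).
Definition smooth_vertex := {x : G | x != e}.
Definition smooth_adj (x y : smooth_vertex) :=
  contract (@adj G) e (val x) (val y).
Lemma smooth_sym : symmetric smooth_adj.
Proof. by move=> x y; apply/contract_sym/adj_sym. Qed.
Lemma smooth_irr : irreflexive smooth_adj.
Proof. by move=> x; rewrite /smooth_adj /contract adj_irr eqxx /= !andbF. Qed.
Definition smooth : graph := Graph smooth_sym smooth_irr.
(** The inclusion is kept under a name of its own so that simplification does
   not unfold it into a projection. *)
Definition emb (x : smooth) : G := val x.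
Arguments emb : simpl never.
Lemma emb_inj : injective emb. Proof. exact: val_inj. Qed.
Lemma emb_neq x : emb x != e. Proof. exact: (valP (x : smooth_vertex)). Qed.
Lemma smooth_adjE (x y : smooth) :
  smooth_adj x y = contract (@adj G) e (emb x) (emb y).
Proof. by []. Qed.

Hypotheses (fG : forest G) (deg_e : deg e = 2).

Lemma smooth_contraction : contraction emb e.
Proof.
split=> //; [exact: emb_inj|move=> y|by rewrite -/(deg e) deg_e|]; last first.
  by move=> x y; apply: (forest_no_triangle fG).
split=> [ye|/codomP[x ->]]; last exact: (emb_neq x).
by apply/codomP; exists (exist _ y ye).
Qed.

Lemma smooth_forest : forest smooth.
Proof.
apply/degenerate_forest/(contraction_degenerate smooth_contraction).
exact: forest_degenerate.
Qed.

Lemma e_nbrs : exists p q : G, [/\ p != q, adj e p, adj e q &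
  forall x, adj e x -> x = p \/ x = q].
Proof.
have /eqP/cards2P[p [q [pq /setP E]]] := deg_e.
have {}E x : adj e x = (x \in [set p; q]) by rewrite -E inE.
by exists p, q; rewrite !E set21 set22; split=> // x; rewrite E => /set2P.
Qed.

Lemma smooth_same : same_shape (bare smooth) (bare G).
Proof.
have [inj_i cod _ _ _] := smooth_contraction.
have [p [q [pq ep eq _]]] := e_nbrs.
apply: (@same_contract (bare smooth) (bare G) emb e) => //.
- by move=> x; apply: (emb_neq x).
- by move=> y /cod.
- by rewrite -/(deg e) deg_e.
- move=> X x _ _ /=.
  transitivity false; [|symmetry]; apply/negbTE/set0Pn.
    by exists (emb x); rewrite inE connect0.
  by exists x; rewrite inE connect0.
- by move=> _; exists p.
move=> u _; case: (eqVneq p (emb u)) => [pu|]; last by exists p.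
by exists q => //; rewrite -pu eq_sym.
Qed.

(** A neighbour of e loses e and gains the other neighbour of e, to which it was
   not adjacent because a forest has no triangle. *)
Lemma deg_smooth (x : smooth) : deg x = deg (emb x).
Proof.
have [p [q [pq ep eq pqP]]] := e_nbrs.
have adjE (y : smooth) : adj x y = adj (emb x) (emb y) ||
    [&& emb x != emb y, adj e (emb x) & adj e (emb y)].
  by rewrite [LHS]smooth_adjE /contract !emb_neq (adj_sym (emb x) e).
case: (boolP (adj e (emb x))) => ex; last first.
  rewrite /deg -(card_imset _ emb_inj); apply: eq_card => y.
  rewrite inE; apply/imsetP/idP => [[z]|xy].
    by rewrite inE adjE (negbTE ex) /= andbF orbF => xz ->.
  have ye : y != e by apply: contraTneq xy => ->; rewrite adj_sym.
  by exists (exist _ y ye) => //; rewrite inE adjE xy.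
have [z [zx ez zP]] : exists z, [/\ z != emb x, adj e z &
    forall y, adj e y -> y != emb x -> y = z].
  case: (pqP _ ex) => ->; [exists q|exists p]; split; rewrite // 1?eq_sym //.
    by move=> y /pqP[]->; rewrite ?eqxx.
  by move=> y /pqP[]->; rewrite ?eqxx.
have ze : z != e by apply: contraTneq ez => ->; rewrite adj_irr.
pose z' : smooth := exist _ z ze.
rewrite /deg (cardsD1 z') (cardsD1 e [set y | adj (emb x) y]) !inE.
rewrite adjE -[emb z']/z (eq_sym _ z) zx ex ez orbT (adj_sym (emb x)) ex.
congr (_ + _).
rewrite -(card_imset _ emb_inj); apply: eq_card => y.
rewrite !inE; apply/imsetP/andP => [[t]|[ye xy]].
  rewrite !inE adjE => /andP[tz xt] ->; split; first exact: (emb_neq t).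
  case/orP: xt => // /and3P[xt _ et].
  by case/eqP: tz; apply: emb_inj; apply: zP; rewrite // eq_sym.
exists (exist _ y ye) => //; rewrite !inE adjE xy andbT.
apply/negP=> /eqP/(congr1 emb); rewrite -[LHS]/y -[RHS]/z => yz.
by have := forest_no_triangle fG ex ez; rewrite -yz xy.
Qed.

(** Inserting e between its two neighbours, and deleting e, are inverse
   bijections between the elements of P for the smoothed graph and for G. *)
Fixpoint reroute (x : smooth) (s : seq smooth) : seq G :=
  if s is y :: s' then
    (if adj e (emb x) && adj e (emb y) then [:: e; emb y] else [:: emb y])
      ++ reroute y s'
  else [::].
Definition reroute_all (g : seq smooth) : seq G :=
  if g is x :: s then emb x :: reroute x s else [::].
Definition drop_e (h : seq G) : seq smooth := pmap insub h.
Arguments drop_e : simpl never.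

Lemma drop_e_val (y : smooth) h : drop_e (emb y :: h) = y :: drop_e h.
Proof. by rewrite /drop_e /= (valK (y : smooth_vertex)). Qed.

Lemma drop_e_e h : drop_e (e :: h) = drop_e h.
Proof. by rewrite /drop_e /= insubF ?eqxx. Qed.

Lemma reroute_allK : cancel reroute_all drop_e.
Proof.
case=> // x s; rewrite /= drop_e_val; congr (_ :: _).
elim: s x => //= y s IHs x; case: ifP => _ /=;
  by rewrite ?drop_e_e drop_e_val IHs.
Qed.

Lemma mem_drop_e y h : (y \in drop_e h) = (emb y \in h).
Proof.
elim: h => //= z h IHh; case: (eqVneq z e) => [->|ze].
  by rewrite drop_e_e IHh inE (negbTE (emb_neq y)).
rewrite -[z]/(emb (exist _ z ze : smooth)) drop_e_val !inE IHh.
by rewrite (inj_eq emb_inj).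
Qed.

Lemma reroute_path x s :
  path (@adj smooth) x s -> path (@adj G) (emb x) (reroute x s).
Proof.
elim: s x => //= y s IHs x /andP[xy /IHs ps].
case: ifP => [/andP[ex ey]|ne] /=; rewrite ps ?ey andbT.
  by rewrite adj_sym ex.
move: xy; rewrite smooth_adjE /contract !emb_neq /=.
case/orP=> [//|/and3P[_ xe ey]].
by rewrite adj_sym xe ey in ne.
Qed.

Lemma last_reroute x s : last (emb x) (reroute x s) = emb (last x s).
Proof. by elim: s x => //= y s IHs x; case: ifP => _ /=. Qed.

Lemma mem_reroute x s (y : smooth) : (emb y \in reroute x s) = (y \in s).
Proof.
rewrite -mem_drop_e; case: (reroute_allK (x :: s)).
by rewrite drop_e_val => -[->].
Qed.

(** If e is inserted somewhere then both neighbours of e occur in the sequence;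
   this is why e is inserted at most once. *)
Lemma nbr_mem_reroute x s z : uniq (x :: s) -> e \in reroute x s ->
  adj e (emb z) -> z \in x :: s.
Proof.
elim: s x => //= y s IHs x /andP[]; rewrite inE negb_or => /andP[xy _] us.
case: ifP => [/andP[ex ey] _ ez|_].
  have [p [q [pq _ _ pqP]]] := e_nbrs.
  rewrite !inE -!(inj_eq emb_inj); move: xy; rewrite -(inj_eq emb_inj) /=.
  by case: (pqP _ ex) (pqP _ ey) (pqP _ ez) => -> [] -> [] ->;
    rewrite ?eqxx ?orbT.
rewrite /= inE eq_sym (negbTE (emb_neq y)) => /(IHs _ us) zs /zs zin.
by rewrite inE zin orbT.
Qed.

Lemma reroute_uniq x s : uniq (x :: s) -> uniq (emb x :: reroute x s).
Proof.
rewrite /= mem_reroute => /andP[xs us]; rewrite xs /=.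
elim: s x xs us => //= y s IHs x xs /andP[ys us].
have := IHs y ys us => uys.
case: ifP => [/andP[ex ey]|_] /=; rewrite mem_reroute ys uys //= andbT.
rewrite inE negb_or eq_sym (emb_neq y) /=.
by apply: contra xs => ein; apply: nbr_mem_reroute ein ex; rewrite /= ys.
Qed.

Lemma reroute_drop x (h : seq G) : uniq (emb x :: h) -> path (@adj G) (emb x) h ->
  last (emb x) h != e ->
  reroute x (drop_e h) = h /\ path (@adj smooth) x (drop_e h).
Proof.
have [n] := ubnP (size h); elim: n x h => // n IHn x [|y h]; first by [].
move=> lt_h /= /and3P[].
rewrite inE negb_or => /andP[xy xh] yh uh /andP[axy ph] le.
case: (eqVneq y e) => [ye|ye].
  case: h => [|z h] in lt_h xh yh uh ph le *; first by rewrite /= ye eqxx in le.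
  move: ph; rewrite ye => /= /andP[ez ph].
  have ze : z != e by apply: contraTneq ez => ->; rewrite adj_irr.
  have [z' zz'] : exists z' : smooth, z = emb z' by exists (exist _ z ze).
  rewrite zz' in xh uh ph le ez *; rewrite drop_e_e drop_e_val /=.
  have [||||-> ps] := IHn z' h => //; first by apply: ltnW.
  rewrite ps ez adj_sym -ye axy /= andbT; split=> //.
  rewrite smooth_adjE /contract !emb_neq -ye axy ye ez.
  by move: xh; rewrite inE negb_or => /andP[-> _]; rewrite orbT.
have [y' yy'] : exists y' : smooth, y = emb y' by exists (exist _ y ye).
rewrite yy' in yh ph le axy *; rewrite drop_e_val /=.
have [||||-> ps] := IHn y' h => //; first by rewrite /= yh.
rewrite ps andbT; split; last by rewrite smooth_adjE /contract !emb_neq axy.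
case: ifP => // /andP[ex ey].
by have := forest_no_triangle fG ex ey; rewrite axy.
Qed.

Lemma in_P_reroute g : in_P g -> in_P (reroute_all g).
Proof.
case: g => // x s /in_PE[us ps ds s0]; apply/in_PE; split.
- exact: reroute_uniq.
- exact: reroute_path.
- move=> y; case: (eqVneq y e) => [-> _|ye].
    rewrite deg_e last_reroute eq_sym (negbTE (emb_neq x)).
    by rewrite eq_sym (negbTE (emb_neq (last x s))).
  rewrite -[y]/(emb (exist _ y ye : smooth)) last_reroute !(inj_eq emb_inj).
  by rewrite -deg_smooth inE mem_reroute (inj_eq emb_inj) => /ds.
by case: s s0 {us ps ds} => [d0 _|y s _]; rewrite -?deg_smooth ?d0 //=; case: ifP.
Qed.

Lemma in_P_head_last (x : G) s : in_P (x :: s) -> x != e /\ last x s != e.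
Proof.
case/in_PE=> _ _ ds _; split; apply/eqP=> xe.
  by have := ds x (mem_head _ _); rewrite {1}xe deg_e !eqxx.
by have := ds _ (mem_last _ _); rewrite {1}xe deg_e !eqxx orbT.
Qed.

Lemma drop_eK h : in_P h -> reroute_all (drop_e h) = h.
Proof.
case: h => // x s Pxs; have [xe le] := in_P_head_last Pxs.
have /in_PE[us ps _ _] := Pxs.
rewrite -[x]/(emb (exist _ x xe : smooth)) drop_e_val /=.
by have [|||->] := @reroute_drop (exist _ x xe) s.
Qed.

Lemma last_drop_e (x : smooth) s : last (emb x) s != e ->
  emb (last x (drop_e s)) = last (emb x) s.
Proof.
elim: s x => //= y s IHs x; case: (eqVneq y e) => [->|ye].
  case: s IHs => [|z s] IHs /=; first by rewrite eqxx.
  by rewrite drop_e_e => /(IHs x).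
by rewrite -[y]/(emb (exist _ y ye : smooth)) drop_e_val /= => /IHs.
Qed.

Lemma in_P_drop h : in_P h -> in_P (drop_e h).
Proof.
case: h => // x s Pxs; have [xe le] := in_P_head_last Pxs.
have /in_PE[us ps ds s0] := Pxs.
move: us ps ds s0 le; rewrite -[x]/(emb (exist _ x xe : smooth)) drop_e_val.
set x' : smooth := exist _ x xe => us ps ds s0 le.
have [rs pd] := reroute_drop us ps le.
apply/in_PE; split=> //.
- by rewrite -drop_e_val; apply: pmap_sub_uniq.
- move=> y ys; rewrite deg_smooth ds.
    by rewrite -last_drop_e // !(inj_eq emb_inj).
  by move: ys; rewrite !inE mem_drop_e.
by move=> d0; rewrite deg_smooth s0 // -rs d0.
Qed.

Lemma smooth_ne2 (v : Vtx_ne2 smooth) : deg (emb (val v)) != 2.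
Proof. by rewrite -deg_smooth (valP v). Qed.
Definition vtx_up (v : Vtx_ne2 smooth) : Vtx_ne2 G :=
  exist (fun x : G => deg x != 2) (emb (val v)) (smooth_ne2 v).

Lemma ne2_neq_e (v : Vtx_ne2 G) : val v != e.
Proof. by apply: contraNneq (valP v) => ->; rewrite deg_e. Qed.
Definition unemb (v : Vtx_ne2 G) : smooth :=
  exist (fun x => x != e) (val v) (ne2_neq_e v).
Lemma unembK v : emb (unemb v) = val v. Proof. by []. Qed.
Lemma unemb_ne2 v : deg (unemb v) != 2.
Proof. by rewrite deg_smooth unembK (valP v). Qed.
Definition vtx_down (v : Vtx_ne2 G) : Vtx_ne2 smooth :=
  exist (fun x : smooth => deg x != 2) (unemb v) (unemb_ne2 v).

Lemma P_joins_up u v g :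
  P_joins u v g -> P_joins (vtx_up u) (vtx_up v) (reroute_all g).
Proof.
case: g => [|x s] [Pg //= [hx] lx]; split; first exact: (in_P_reroute Pg).
  by rewrite /= hx.
by rewrite /= last_reroute lx.
Qed.

Lemma P_joins_down u v h :
  P_joins u v h -> P_joins (vtx_down u) (vtx_down v) (drop_e h).
Proof.
case: h => [|x s] [Ph //= [hx] lx]; have [xe le] := in_P_head_last Ph.
have PD := in_P_drop Ph.
move: PD le lx; rewrite -[x]/(emb (exist _ x xe : smooth)) drop_e_val.
move=> PD le lx.
split=> //=; first by congr Some; apply: emb_inj.
by apply: emb_inj; rewrite last_drop_e.
Qed.

Lemma smooth_skeleton (S : graph) : skeleton_of S smooth <-> skeleton_of S G.
Proof.
split=> -[skS [f [[vf [fP surj]] inj_f]]]; split=> //.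
  exists (vtx_up \o f); split; last first.
    move=> u v uv /(congr1 val) /= fuv; apply: inj_f => //.
    exact/val_inj/emb_inj.
  exists (reroute_all \o vf); split=> [u v g /fP|h Ph]; first exact: P_joins_up.
  have [g Pg vg] := surj _ (in_P_drop Ph).
  by exists g; rewrite //= vg drop_eK.
exists (vtx_down \o f); split; last first.
  move=> u v uv /(congr1 val)/(congr1 val) /= fuv; apply: inj_f => //.
  exact/val_inj.
exists (drop_e \o vf); split=> [u v g /fP|h Ph]; first exact: P_joins_down.
have [g Pg vg] := surj _ (in_P_reroute Ph).
by exists g; rewrite //= vg reroute_allK.
Qed.
End Smooth.

(** * Forests without vertices of degree 2 *)
Lemma deg_neq0P (G : graph) (x : G) : reflect (exists y, adj x y) (deg x != 0).
Proof.
rewrite /deg cards_eq0; apply: (iffP (set0Pn _)) => -[y xy].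
  by exists y; rewrite inE in xy.
by exists y; rewrite inE.
Qed.

Section NoChain.
Variable G : graph.
Hypothesis ne2 : forall x : G, deg x != 2.

Lemma in_P_edge (x y : G) : adj x y -> in_P [:: x; y].
Proof.
move=> xy; have nxy : x != y by apply: contraTneq xy => ->; rewrite adj_irr.
apply/in_PE; split=> //; rewrite /= ?xy ?inE ?nxy //.
by move=> z; rewrite ne2 !inE => ->.
Qed.

(** An interior vertex of an element of P has degree 2. *)
Lemma in_P_short (g : seq G) : in_P g ->
  (exists2 x, g = [:: x] & deg x = 0) \/ exists x y, g = [:: x; y] /\ adj x y.
Proof.
case: g => // x [|y s] /in_PE[us ps ds s0].
  by left; exists x; rewrite ?s0.
have /= /andP[xy _] := ps.
right; exists x, y; split=> //; case: s us {ps s0} ds => // z s us ds.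
have yin : y \in [:: x, y, z & s] by rewrite !inE eqxx orbT.
have [xy' ynz] : x != y /\ y \notin z :: s.
  by move: us => /= /and3P[]; rewrite in_cons negb_or => /andP[].
have := ds y yin; rewrite ne2 eq_sym (negbTE xy') /= => /esym/eqP ylast.
by case/negP: ynz; rewrite ylast mem_last.
Qed.
End NoChain.

(** Without vertices of degree 2, a skeleton is obtained by turning every isolated
   vertex into an edge: such a vertex v contributes the path (v) to P, which has
   to be the image of an edge. *)
Section Base.
Variable G : graph.
Hypotheses (fG : forest G) (ne2 : forall x : G, deg x != 2).

Definition split_vertex : finType := (G + {x : G | deg x == 0})%type.
Definition split_proj (a : split_vertex) : G :=
  match a with inl x => x | inr z => val z end.
Definition split_adj (a b : split_vertex) : bool :=
  match a, b with
  | inl x, inl y => adj x y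
  | inl x, inr z | inr z, inl x => x == val z
  | inr _, inr _ => false
  end.
Lemma split_sym : symmetric split_adj.
Proof. by move=> [x|z] [y|z'] //=; rewrite adj_sym. Qed.
Lemma split_irr : irreflexive split_adj.
Proof. by move=> [x|z] //=; rewrite adj_irr. Qed.
Definition split_isolated : graph := Graph split_sym split_irr.
Local Notation S := split_isolated.

Lemma deg_inr z : deg (inr z : S) = 1.
Proof.
apply/eqP/cards1P; exists (inl (val z)); apply/setP=> -[x|z'] /[!inE] //.
Qed.

Lemma deg_inl x : deg (inl x : S) = if deg x == 0 then 1 else deg x.
Proof.
case: (boolP (deg x == 0)) => dx.
  apply/eqP/cards1P; exists (inr (exist _ x dx)); apply/setP=> -[y|z] /[!inE] /=.
    apply/negP=> xy; have := dx; apply/negP/deg_neq0P; by exists y.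
  by rewrite (inj_eq inr_inj) -val_eqE /= eq_sym.
rewrite /deg -(card_imset [set y | adj x y] (@inl_inj G {x : G | deg x == 0})).
apply: eq_card => -[y|z]; rewrite !inE /=.
  by rewrite mem_imset ?inE //; apply: inl_inj.
transitivity false; last by apply/esym/imsetP => -[].
by apply: contraNF dx => /eqP->; apply: (valP z).
Qed.

Lemma split_forest : forest S.
Proof.
apply: degenerate_forest => X X0.
case: (pickP (fun z : {x : G | deg x == 0} => (inr z : S) \in X)) => [z zX|nz].
  exists (inr z) => //; rewrite -(deg_inr z).
  apply/subset_leq_card/subsetP=> b.
  by rewrite !inE => /andP[].
have [|x] := forest_degenerate fG (X := [set x | (inl x : S) \in X]).
  case/set0Pn: X0 => -[x xX|z zX]; last by rewrite nz in zX.
  by apply/set0Pn; exists x; rewrite inE.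
rewrite inE => xX; set Y := [set _ | _] => Y1; exists (inl x) => //.
apply: leq_trans Y1; rewrite -(card_imset _ (@inl_inj G {x : G | deg x == 0})).
apply/subset_leq_card/subsetP=> -[y|z] /[!inE] /andP[bX xb].
  by apply/imsetP; exists y; rewrite ?inE ?bX.
by rewrite nz in bX.
Qed.

Lemma split_skeleton : skeleton S.
Proof.
split; first exact: split_forest.
case=> [x|z]; rewrite ?deg_inr ?deg_inl //.
by case: ifP => // /negbT dx; split.
Qed.

Lemma split_neq2 a : deg (a : S) != 2.
Proof. by have [_ /(_ a)[]] := split_skeleton. Qed.

Definition split_map (a : Vtx_ne2 S) : Vtx_ne2 G :=
  exist (fun x : G => deg x != 2) (split_proj (val a)) (ne2 _).

Lemma split_skeleton_of : skeleton_of S G.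
Proof.
split; first exact: split_skeleton.
exists split_map; split; last first.
  move=> [a pa] [b pb]; rewrite -val_eqE /= => ab /(congr1 val) /= pab.
  exists [:: a; b]; split=> //; apply: in_P_edge; first exact: split_neq2.
  case: a b ab pab {pa pb} => [x|z] [y|z'] //=.
  - by move=> nxy xy; rewrite xy eqxx in nxy.
  - by move=> _ ->.
  - by move=> _ ->.
  - by move=> nzz /val_inj zz; rewrite zz eqxx in nzz.
pose vf (g : seq S) : seq G :=
  if g is [:: a; b] then
    if split_proj a == split_proj b then [:: split_proj a]
    else [:: split_proj a; split_proj b]
  else [::].
exists vf; split.
  move=> u v g [Pg hg lg].
  have [[a ga da]|[a [b [gab ab]]]] := in_P_short split_neq2 Pg.
    by have [_ /(_ a)[]] := split_skeleton; rewrite da.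
  rewrite gab /= in hg lg *; case: hg => au.
  have [P0 P1] : (split_proj a = split_proj b -> deg (split_proj a) = 0) /\
      (split_proj a != split_proj b -> adj (split_proj a) (split_proj b)).
    case: a b ab {gab lg au} => [x|z] [y|z'] //= ab.
    - by split=> // xy; rewrite xy adj_irr in ab.
    - by rewrite (eqP ab) eqxx; split=> // _; apply/eqP/(valP z').
    - by rewrite (eqP ab) eqxx; split=> // _; apply/eqP/(valP z).
  case: eqVneq => [pab|/P1 pab]; first by split; rewrite /= -?au -?lg ?P0.
  by split; rewrite /= -?au -?lg //; apply: in_P_edge.
move=> h Ph; have [[x -> dx]|[x [y [-> xy]]]] := in_P_short ne2 Ph.
  have dx0 : deg x == 0 by rewrite dx.
  exists [:: inl x; inr (exist _ x dx0)]; last by rewrite /= eqxx.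
  by apply: in_P_edge => //=; apply: split_neq2.
exists [:: inl x; inl y]; first by apply: in_P_edge => //; apply: split_neq2.
by rewrite /=; case: eqVneq xy => // ->; rewrite adj_irr.
Qed.
End Base.

(** Without vertices of degree 2, a skeletal map is an isomorphism except over the
   isolated vertices: onto each of them it folds a component that is an edge. *)
Section Unique.
Variables (G S : graph) (f : Vtx_ne2 S -> Vtx_ne2 G).
Hypotheses (ne2 : forall x : G, deg x != 2).
Hypotheses (skS : skeleton S) (fS : skeletal_map f).

Lemma skeleton_neq2 (u : S) : deg u != 2.
Proof. by have [_ /(_ u)[]] := skS. Qed.
Definition vtx (u : S) : Vtx_ne2 S :=
  exist (fun u : S => deg u != 2) u (skeleton_neq2 u).
Definition image_vtx (u : S) : G := val (f (vtx u)).

Lemma P_joins_edge (u v : S) : adj u v -> P_joins (vtx u) (vtx v) [:: u; v].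
Proof. by move=> uv; split=> //; apply: in_P_edge => //; apply: skeleton_neq2. Qed.

Lemma image_adj (u v : S) : adj u v ->
  (image_vtx u = image_vtx v /\ deg (image_vtx u) = 0) \/
  adj (image_vtx u) (image_vtx v).
Proof.
have [[vf [fP _]] _] := fS.
move/P_joins_edge/fP; rewrite /image_vtx => -[Ph].
have [[x -> dx]|[x [y [-> xy]]]] := in_P_short ne2 Ph; move=> /= [<-] <-.
  by left.
by right.
Qed.

Lemma image_lift h : in_P h -> exists u v,
  [/\ adj u v, ohead h = Some (image_vtx u) &
      last (image_vtx u) h = image_vtx v].
Proof.
have [[vf [fP surj]] _] := fS; case/surj=> g Pg <-.
have [[u gu du]|[u [v [guv uv]]]] := in_P_short skeleton_neq2 Pg.
  by have [_ /(_ u)[]] := skS; rewrite du.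
by exists u, v; rewrite guv; have [_] := fP _ _ _ (P_joins_edge uv).
Qed.

Lemma image_lift_edge x y : adj x y ->
  exists u v, [/\ adj u v, image_vtx u = x & image_vtx v = y].
Proof.
move/(in_P_edge ne2)/image_lift=> [u [v [uv [xu] yv]]].
by exists u, v; rewrite -yv -xu.
Qed.

Lemma image_surj x : exists u, image_vtx u = x.
Proof.
have [/deg_neq0P[y /image_lift_edge[u [v [_ <- _]]]]|] := boolP (deg x != 0).
  by exists u.
rewrite negbK => /eqP dx; have : in_P [:: x] by [].
by case/image_lift=> u [v [_ [xu] _]]; exists u.
Qed.

Lemma image_eq u v : u != v -> image_vtx u = image_vtx v -> adj u v.
Proof.
have [_ inj_f] := fS; move=> uv /val_inj/inj_f[]; first exact: uv.
move=> g [Pg hg lg].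
have [[x gx dx]|[x [y [gxy xy]]]] := in_P_short skeleton_neq2 Pg.
  by have [_ /(_ x)[]] := skS; rewrite dx.
by move: hg lg; rewrite gxy /= => -[<-] <-.
Qed.

(** Two vertices with the same image are adjacent, and an edge is folded only
   onto an isolated vertex. *)
Lemma image_single u :
  deg (image_vtx u) != 0 -> single (image_vtx : bare S -> bare G) u.
Proof.
move=> du v Fvu; apply/eqP; apply: contraT => vu.
case: (image_adj (image_eq vu Fvu)) => [[_ d0]|]; last by rewrite Fvu adj_irr.
by rewrite -Fvu d0 in du.
Qed.

Lemma image_connect (X : pred G) u v : X (image_vtx u) ->
  connect (@inside (bare G) X) (image_vtx u) (image_vtx v) =
  connect (@inside (bare S) (X \o image_vtx)) u v.
Proof.
move=> Xu; apply/idP/idP=> c.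
  suff P y : connect (@inside (bare G) X) (image_vtx u) y ->
      forall v, image_vtx v = y ->
      connect (@inside (bare S) (X \o image_vtx)) u v.
    exact: (P (image_vtx v)).
  have same_fiber s t : X (image_vtx s) -> image_vtx s = image_vtx t ->
      connect (@inside (bare S) (X \o image_vtx)) s t.
    case: (eqVneq s t) => [->|st] Xs Fst; first exact: connect0.
    by apply: connect1; rewrite /inside /= -Fst Xs image_eq.
  elim/connect_ind: y / => [v' /esym|y z cy IHy /and3P[Xy Xz yz] v' Fv'].
    exact: same_fiber.
  have [s [t [st Fs Ft]]] := image_lift_edge yz.
  apply: connect_trans (IHy s Fs) _.
  apply: (@connect_trans _ _ t); last by apply: same_fiber; rewrite Ft.
  by apply: connect1; rewrite /inside /= Fs Ft Xy Xz.
elim/connect_ind: v / c => // y z _ cy /and3P[/= Xy Xz yz].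
apply: (connect_trans cy).
case: (image_adj yz) => [[-> _]|Fyz]; first exact: connect0.
by apply: connect1; rewrite /inside Xy Xz.
Qed.

(** The invariants match because no node u is folded: otherwise all its neighbours
   would be mapped to the same isolated vertex, hence be pairwise adjacent, and
   two of them would form a triangle with u. *)
Lemma no_chain_same : same_shape (bare S) (bare G).
Proof.
have image_codom z : z \in codom image_vtx.
  by have [u <-] := image_surj z; apply: codom_f.
apply: (@same_map (bare S) (bare G) image_vtx) => //.
- by move=> X x y _ Xx _; apply: image_connect.
- move=> x nx; have [u Fu] := image_surj x; exists u => //; apply: image_single.
  rewrite Fu -lt0n; apply: (@leq_trans 3) => //.
  exact: leq_trans nx (nlive_le_deg (x : bare G)).
- move=> u nu; apply: image_single; apply/eqP=> du.
  have : 1 < deg u.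
    by apply: leq_trans (nlive_le_deg (u : bare S)); apply: ltnW.
  case/card_gt1P=> v [w [/[!inE] uv uw vw]].
  have Fu t : adj u t -> image_vtx t = image_vtx u.
    case/image_adj=> [[->]//|Fut].
    have /negP[] : ~~ (deg (image_vtx u) != 0) by rewrite du.
    by apply/deg_neq0P; exists (image_vtx t).
  have vw' : adj v w by apply: image_eq; rewrite // !Fu.
  by have [fS' _] := skS; have := forest_no_triangle fS' uv uw; rewrite vw'.
- by move=> z _; have [u <-] := image_surj z; exists u; apply: connect0.
- by move=> u z _ _; have [t <-] := image_surj z; exists t; apply: connect0.
- move=> X x _ _; transitivity false; [|symmetry]; apply/negbTE/set0Pn.
    by exists (image_vtx x); rewrite inE connect0.
  by exists x; rewrite inE connect0.
move=> u x su xu.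
have offF y : off (image_vtx u : bare G) (image_vtx y) = off (u : bare S) y.
  by rewrite /off; congr (~~ _); apply/eqP/eqP => [/su|->].
have connF y :
    connect (inside (off (image_vtx u : bare G))) (image_vtx x) (image_vtx y) =
    connect (inside (off (u : bare S))) x y.
  rewrite image_connect; last by rewrite offF.
  by apply/eq_connect/eq_inside => z; apply: offF.
apply/existsP/existsP=> -[y /andP[cy uy]].
  have [u' [v [uv Fu' Fv]]] := image_lift_edge uy.
  by exists v; rewrite -connF Fv cy /= -(su u' Fu').
exists (image_vtx y); rewrite connF cy /=; case: (image_adj uy) => // -[/esym/su yu].
by move: uy; rewrite yu adj_irr.
Qed.
End Unique.

(** Induction on the number of vertices, smoothing as long as possible. *)
Lemma skeleton_exists_same (G : graph) : forest G ->
  (exists S, skeleton_of S G) /\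
  (forall S, skeleton_of S G -> same_shape (bare S) (bare G)).
Proof.
have [n] := ubnP #|G|; elim: n G => // n IHn G; rewrite ltnS => leGn fG.
case: (pickP (fun e : G => deg e == 2)) => [e /eqP de|ne2].
  have [||[S skS] uniqS] := IHn (smooth e).
  - apply: leq_trans leGn; rewrite card_sig.
    rewrite [X in _ < X](cardD1 e) ltnS.
    by apply/subset_leq_card/subsetP=> x; rewrite !inE andbT.
  - exact: smooth_forest.
  split; first by exists S; apply/(smooth_skeleton fG de).
  move=> S' /(smooth_skeleton fG de)/uniqS sS'.
  exact: same_trans sS' (smooth_same fG de).
have {}ne2 (x : G) : deg x != 2 by apply/negbT/ne2.
split; first by exists (split_isolated G); apply: split_skeleton_of.
by move=> S [skS [f fS]]; apply: no_chain_same fS.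
Qed.

Theorem corollary3p6 (C : wgraph -> Prop) (G0 : wgraph)
    (hG0 : forest G0) (hC : forall G : wgraph, C G <-> wequiv G0 G)
    (G1 G2 : wgraph) (hG1 : C G1) (hG2 : C G2)
    (min1 : minimal G1) (min2 : minimal G2) :
  (exists S1 : graph, skeleton_of S1 G1) /\
  (exists S2 : graph, skeleton_of S2 G2) /\
  (forall S1 S2 : graph,
     skeleton_of S1 G1 -> skeleton_of S2 G2 -> graph_iso S1 S2).
Proof.
move: hG1 hG2 => /hC e1 /hC e2.
have f1 := wequiv_forest e1 hG0; have f2 := wequiv_forest e2 hG0.
have [ex1 same1] := skeleton_exists_same f1.
have [ex2 same2] := skeleton_exists_same f2.
split=> //; split=> // S1 S2 sk1 sk2.
apply: same_skeleton_iso; [by case: sk1|by case: sk2|].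
apply: same_trans (same1 _ sk1) _; apply: same_trans (same_sym (same2 _ sk2)).
apply: same_trans (same_sym (minimal_same f1 min1)) _.
apply: same_trans (minimal_same f2 min2).
exact: same_trans (same_sym (wequiv_same e1)) (wequiv_same e2).
Qed.
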